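(* Let $\Bbbk$ be a field of characteristic zero and let $\mathcal{O}=\mathcal{P}(E,R)=\mathcal{F}(E)/(R)$ be a quadratic Koszul graded operad over $\Bbbk$, with $E$ a reduced graded $\mathbb{S}$-module. If $A$ is a formal DG-$\mathcal{O}$-algebra, then all Massey products in $H_*(A)$ vanish; that is, for every relation $\Gamma=\sum(\mu^{(1)}\circ_l\mu^{(2)})\cdot\sigma\in R(r)$ and all homogeneous $x_1,\dots,x_r\in H_*(A)$ such that $\mu^{(2)}(x_{\sigma^{-1}(l)},\dots,x_{\sigma^{-1}(l+r_2-1)})=0$ in $H_*(A)$ for each summand of $\Gamma$, the Massey product $\langle x_1,\dots,x_r\rangle_\Gamma$ is zero in the quotient of $H_{|\Gamma|+\sum_i|x_i|+1}(A)$ in which it is defined.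
   Context: Operads are symmetric operads in graded $\Bbbk$-vector spaces with homological grading; $|x|$ is the degree of $x$. $\mathcal{F}(E)$ is the free operad on $E$ and $R\subset\mathcal{F}(E)^{(2)}$ is a sub-$\mathbb{S}$-module of the weight $2$ part. In $\Gamma=\sum(\mu^{(1)}\circ_l\mu^{(2)})\cdot\sigma$ all symbols depend on the summand: $\mu^{(1)}\in E(r_1)$, $\mu^{(2)}\in E(r_2)$ homogeneous, $r_1+r_2-1=r$, $1\le l\le r_1$, $\sigma\in\mathbb{S}_r$, and $|\mu^{(1)}|+|\mu^{(2)}|=|\Gamma|$. On algebras, $(\mu\cdot\sigma)(x_1,\dots,x_r)=(-1)^{\alpha}\mu(x_{\sigma^{-1}(1)},\dots,x_{\sigma^{-1}(r)})$ with $\alpha=\sum_{s<t,\,\sigma(s)>\sigma(t)}|x_s||x_t|$. Massey product: choose cycles $y_i\in A$ representing $x_i$ and, for each summand of $\Gamma$, $\rho^{(2)}\in A$ with $d(\rho^{(2)})=\mu^{(2)}(y_{\sigma^{-1}(l)},\dots,y_{\sigma^{-1}(l+r_2-1)})$. Then $\langle x_1,\dots,x_r\rangle_\Gamma$ is the element of the quotient $$\frac{H_{|\Gamma|+\sum_{i=1}^r|x_i|+1}(A)}{\sum\mu^{(1)}\bigl(x_{\sigma^{-1}(1)},\dots,x_{\sigma^{-1}(l-1)},H_{|\mu^{(2)}|+\sum_{i=1}^{r_2}|x_{\sigma^{-1}(l+i-1)}|+1}(A),x_{\sigma^{-1}(l+r_2)},\dots,x_{\sigma^{-1}(r)}\bigr)}$$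 (the denominator is a sum of subspaces over the summands of $\Gamma$) represented by the homology class of the cycle $$\sum(-1)^{\gamma}\mu^{(1)}(y_{\sigma^{-1}(1)},\dots,y_{\sigma^{-1}(l-1)},\rho^{(2)},y_{\sigma^{-1}(l+r_2)},\dots,y_{\sigma^{-1}(r)}),\quad \gamma=\alpha+|\mu^{(1)}|+(|\mu^{(2)}|-1)\sum_{m=1}^{l-1}|x_{\sigma^{-1}(m)}|.$$ It is independent of the choices. A DG-$\mathcal{O}$-algebra $A$ is formal if it is quasi-isomorphic, as a DG-$\mathcal{O}$-algebra (through a zigzag of quasi-isomorphisms), to its homology $H_*(A)$ with the induced graded $\mathcal{O}$-algebra structure and zero differential. *)

(* Defs.v *)
From HB Require Import structures.
From mathcomp Require Import all_boot all_order all_fingroup all_algebra.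
From mathcomp Require Import boolp.
From mathcomp Require freeg.

Set Implicit Arguments.
Unset Strict Implicit.
Unset Printing Implicit Defensive.
Import GRing.Theory.
Local Open Scope ring_scope.
Local Open Scope quotient_scope.

Section Submodules.
Context (k : nzRingType) (V : lmodType k).

Record submodule := Submodule {
  smem :> V -> Prop;
  smem0 : smem 0;
  smemL : forall a u v, smem u -> smem v -> smem (a *: u + v) }.

Definition spred (S : submodule) : {pred V} := fun v => `[< S v >].

Lemma spredP (S : submodule) v : reflect (S v) (v \in spred S).
Proof. exact: asboolP. Qed.

Lemma spred_submod_closed (S : submodule) : GRing.submod_closed (spred S).
Proof.
split=> [|a u v /spredP Su /spredP Sv]; first by apply/spredP; exact: smem0.
by apply/spredP; exact: smemL.
Qed.
Lemma spred_zmod_closed (S : submodule) : zmod_closed (spred S).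
Proof. exact/GRing.submod_closedB/spred_submod_closed. Qed.
HB.instance Definition _ (S : submodule) :=
  GRing.isSubmodClosed.Build k V (spred S) (spred_submod_closed S).
HB.instance Definition _ (S : submodule) :=
  GRing.isZmodClosed.Build V (spred S) (spred_zmod_closed S).

Record sub_of (S : submodule) := SubOf { sub_val : V; _ : sub_val \in spred S }.
HB.instance Definition _ (S : submodule) := [isSub for @sub_val S].
HB.instance Definition _ (S : submodule) := [Choice of sub_of S by <:].
HB.instance Definition _ (S : submodule) :=
  [SubChoice_isSubLmodule of sub_of S by <:].

Lemma sub_ofP (S : submodule) (v : sub_of S) : S (\val v).
Proof. exact/spredP/(valP v). Qed.

Definition to_sub (S : submodule) v (h : S v) : sub_of S :=
  SubOf (introT (spredP S v) h).

Definition mquot (S : submodule) := Quotient.quot (spred S).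
HB.instance Definition _ (S : submodule) := GRing.Zmodule.on (mquot S).
HB.instance Definition _ (S : submodule) := Quotient.on (mquot S).

Definition mcls (S : submodule) (v : V) : mquot S := \pi_(mquot S) v.

Definition mrepr (S : submodule) (q : mquot S) : V := generic_quotient.repr q.

Lemma mcls_eq (S : submodule) u v : (mcls S u = mcls S v) <-> S (u - v).
Proof.
rewrite /mcls; split=> [/eqP|h].
  by rewrite -(Quotient.idealrBE (spred S)) => /spredP.
by apply/eqP; rewrite -(Quotient.idealrBE (spred S)); apply/spredP.
Qed.

Lemma mcls_repr (S : submodule) (q : mquot S) : mcls S (mrepr q) = q.
Proof. exact: reprK. Qed.

Lemma mcls_B (S : submodule) : {morph mcls S : u v / u - v}.
Proof. move=> u v; exact: (raddfB (\pi_(Quotient.quot (spred S)))). Qed.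

Lemma mcls_D (S : submodule) : {morph mcls S : u v / u + v}.
Proof. move=> u v; exact: (raddfD (\pi_(Quotient.quot (spred S)))). Qed.

Definition mscale (S : submodule) (a : k) (q : mquot S) : mquot S :=
  mcls S (a *: mrepr q).

Lemma mscale_pi (S : submodule) a u : mscale a (mcls S u) = mcls S (a *: u).
Proof.
apply/mcls_eq; rewrite -scalerBr -[_ *: _]addr0; apply: smemL (smem0 S).
by apply/mcls_eq; rewrite mcls_repr.
Qed.

Lemma mscaleA (S : submodule) a b (q : mquot S) :
  mscale a (mscale b q) = mscale (a * b) q.
Proof. by rewrite -(mcls_repr q) !mscale_pi scalerA. Qed.
Lemma mscale1 (S : submodule) : left_id 1 (@mscale S).
Proof. by move=> q; rewrite -(mcls_repr q) mscale_pi scale1r. Qed.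
Lemma mscaleDr (S : submodule) : right_distributive (@mscale S) +%R.
Proof.
move=> a p q; rewrite -(mcls_repr p) -(mcls_repr q).
by rewrite !(mscale_pi, =^~ mcls_D) scalerDr.
Qed.
Lemma mscaleDl (S : submodule) (q : mquot S) :
  {morph (@mscale S)^~ q : a b / a + b}.
Proof.
by move=> a b; rewrite -(mcls_repr q) !(mscale_pi, =^~ mcls_D) scalerDl.
Qed.

HB.instance Definition _ (S : submodule) :=
  GRing.Zmodule_isLmodule.Build k (mquot S)
    (@mscaleA S) (@mscale1 S) (@mscaleDr S) (@mscaleDl S).

Lemma mcls_linear (S : submodule) : linear (mcls S).
Proof. by move=> a u v; rewrite mcls_D -mscale_pi. Qed.
HB.instance Definition _ (S : submodule) :=
  GRing.isLinear.Build k V (mquot S) *:%R (mcls S) (mcls_linear S).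

End Submodules.

(** Input [i] of an operation with [m] inputs is replaced by an operation with
    [n] inputs; the composite has [r = m + n - 1] inputs.  All arities are
    [0]-based.  [inner_pos q] is the position in the composite of the [q]-th
    input of the inner operation, [outer_pos j] that of the input [lift i j] of
    the outer one.  The arity of the composite is a parameter subject to an
    equation (and likewise for degrees), so that no transport is needed. *)

Section Positions.
Context (m n r : nat) (hr : (m + n = r.+1)%N) (i : 'I_m).

Lemma inner_pos_subproof (q : 'I_n) : (i + q < r)%N.
Proof.
rewrite -ltnS -hr -addSn; case: m i hr => [[]|m'] // i' _.
by rewrite -addnS leq_add.
Qed.
Definition inner_pos (q : 'I_n) : 'I_r := Ordinal (inner_pos_subproof q).

Lemma outer_pos_subproof (j : 'I_m.-1) :
  ((if (j < i)%N then j : nat else (j + n)%N) < r)%N.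
Proof.
case: m i hr j => [[]|m'] // i' /eqP; rewrite addSn eqSS => /eqP hr' j /=.
case: ifP => [ltji|_]; last by rewrite -hr' ltn_add2r.
rewrite -hr'; apply: (leq_trans (n := m')); last by rewrite leq_addr.
exact: ltn_ord.
Qed.
Definition outer_pos (j : 'I_m.-1) : 'I_r := Ordinal (outer_pos_subproof j).

(** The arguments of the outer operation, when the inner one yields [w]. *)
Definition graft (T : Type) (x : 'I_r -> T) (w : T) (j : 'I_m) : T :=
  if unlift i j is Some j' then x (outer_pos j') else w.

Lemma inner_pos_inj : injective inner_pos.
Proof. by move=> p q /(congr1 val) /= /addnI /val_inj. Qed.

Lemma outer_pos_inj : injective outer_pos.
Proof.
move=> p q /(congr1 val) /=; case: ltnP => hp; case: ltnP => hq; last first.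
- by move/addIn/val_inj.
- by move=> e; move: hq; rewrite -e => /(leq_ltn_trans (leq_addr n p)); rewrite ltnNge hp.
- by move=> e; move: hp; rewrite e => /(leq_ltn_trans (leq_addr n q)); rewrite ltnNge hq.
- exact: val_inj.
Qed.

Lemma inner_outer_neq q j : inner_pos q != outer_pos j.
Proof.
apply/eqP => /(congr1 val) /=; case: ltnP => hj e.
  by move: hj; rewrite -e ltnNge leq_addr.
move: (ltn_ord q); rewrite -(ltn_add2l j) -e ltnNge.
by rewrite leq_add2r hj.
Qed.

Lemma sum_positions (U : zmodType) (F : 'I_r -> U) :
  \sum_p F p = \sum_q F (inner_pos q) + \sum_j F (outer_pos j).
Proof.
pose h (s : 'I_n + 'I_m.-1) :=
  match s with inl q => inner_pos q | inr j => outer_pos j end.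
have hinj : injective h.
  move=> [q|j] [q'|j'] /= e.
  - by rewrite (inner_pos_inj e).
  - by have := inner_outer_neq q j'; rewrite e eqxx.
  - by have := inner_outer_neq q' j; rewrite e eqxx.
  - by rewrite (outer_pos_inj e).
have hbij : bijective h.
  apply: inj_card_bij hinj _; rewrite card_sum !card_ord addnC.
  by case: m i hr => [[]|m'] // _; rewrite addSn => -[->].
rewrite (reindex h) /=; last exact/onW_bij.
by rewrite big_sumType.
Qed.

Lemma sum_graft (T : Type) (U : zmodType) (F : T -> U) x w :
  \sum_j F (graft x w j) = F w + \sum_j F (x (outer_pos j)).
Proof.
rewrite (bigD1_ord i) //= /graft unlift_none; congr (_ + _).
by apply: eq_bigr => j _; rewrite liftK.
Qed.

End Positions.

Section Operads.
Context (k : fieldType).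

Definition sgn (n : int) : k := (-1) ^ n.

(** A graded vector space is a family of vector spaces indexed by [int]; in
    [M r d], [r] is the arity and [d] the degree.  The action is on the right;
    as [(s * t) i = t (s i)] for permutations, [t * s] is the usual composite
    of [s] after [t]. *)
Record smodule := SModule {
  scar :> nat -> int -> lmodType k;
  sact : forall r d, scar r d -> 'S_r -> scar r d;
  sact_lin : forall r d (s : 'S_r) a (x y : scar r d),
    sact (a *: x + y) s = a *: sact x s + sact y s;
  sact1 : forall r d (x : scar r d), sact x 1%g = x;
  sactM : forall r d (x : scar r d) (s t : 'S_r),
    sact (sact x s) t = sact x (t * s)%g }.

(** The two equivariance axioms characterize the block permutation [t]
    associated with [s] by its values. *)
Record operad := Operad {
  osm :> smodule;
  oid : osm 1%N 0;
  ocomp : forall m n r (d e f : int), (m + n = r.+1)%N -> d + e = f ->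
    'I_m -> osm m d -> osm n e -> osm r f;
  ocomp_linl : forall m n r (d e f : int) (hr : (m + n = r.+1)%N) (hd : d + e = f)
      (i : 'I_m) a (x y : osm m d) (z : osm n e),
    ocomp hr hd i (a *: x + y) z = a *: ocomp hr hd i x z + ocomp hr hd i y z;
  ocomp_linr : forall m n r (d e f : int) (hr : (m + n = r.+1)%N) (hd : d + e = f)
      (i : 'I_m) a (x : osm m d) (y z : osm n e),
    ocomp hr hd i x (a *: y + z) = a *: ocomp hr hd i x y + ocomp hr hd i x z;
  ocomp_idl : forall n (d : int) (hr : (1 + n = n.+1)%N) (hd : 0 + d = d) (i : 'I_1)
      (x : osm n d),
    ocomp hr hd i oid x = x;
  ocomp_idr : forall m (d : int) (hr : (m + 1 = m.+1)%N) (hd : d + 0 = d) (i : 'I_m)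
      (x : osm m d),
    ocomp hr hd i x oid = x;
  ocomp_seq : forall l m n p q r (d e f g h c : int)
      (hp : (l + m = p.+1)%N) (hr : (p + n = r.+1)%N)
      (hq : (m + n = q.+1)%N) (hr' : (l + q = r.+1)%N)
      (hg : d + e = g) (hc : g + f = c) (hh : e + f = h) (hc' : d + h = c)
      (i : 'I_l) (j : 'I_m) (x : osm l d) (y : osm m e) (z : osm n f),
    ocomp hr hc (inner_pos hp i j) (ocomp hp hg i x y) z
    = ocomp hr' hc' i x (ocomp hq hh j y z);
  ocomp_par : forall l m n p q r (d e f g h c : int)
      (hp : (l + m = p.+1)%N) (hr : (p + n = r.+1)%N)
      (hq : (l + n = q.+1)%N) (hr' : (q + m = r.+1)%N)
      (hg : d + e = g) (hc : g + f = c) (hh : d + f = h) (hc' : h + e = c)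
      (i j : 'I_l) (i' j' : 'I_l.-1) (x : osm l d) (y : osm m e) (z : osm n f),
    lift i j' = j -> lift j i' = i ->
    ocomp hr hc (outer_pos hp i j') (ocomp hp hg i x y) z
    = sgn (e * f) *: ocomp hr' hc' (outer_pos hq j i') (ocomp hq hh j x z) y;
  ocomp_actl : forall m n r (d e f : int) (hr : (m + n = r.+1)%N) (hd : d + e = f)
      (i : 'I_m) (x : osm m d) (y : osm n e) (s : 'S_m) (t : 'S_r),
    (forall q, t (inner_pos hr i q) = inner_pos hr (s i) q) ->
    (forall j j', s (lift i j) = lift (s i) j' ->
       t (outer_pos hr i j) = outer_pos hr (s i) j') ->
    ocomp hr hd i (sact x s) y = sact (ocomp hr hd (s i) x y) t;
  ocomp_actr : forall m n r (d e f : int) (hr : (m + n = r.+1)%N) (hd : d + e = f)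
      (i : 'I_m) (x : osm m d) (y : osm n e) (s : 'S_n) (t : 'S_r),
    (forall q, t (inner_pos hr i q) = inner_pos hr i (s q)) ->
    (forall j, t (outer_pos hr i j) = outer_pos hr i j) ->
    ocomp hr hd i x (sact y s) = sact (ocomp hr hd i x y) t }.

(** Formal operadic expressions on the generators [E], up to the congruence
    generated by the axioms of operads. *)
Inductive fterm (E : smodule) : nat -> int -> Type :=
| TGen r d : E r d -> fterm E r d
| TId : fterm E 1 0
| TComp m n r (d e f : int) : (m + n = r.+1)%N -> d + e = f ->
    'I_m -> fterm E m d -> fterm E n e -> fterm E r f
| TAct r d : fterm E r d -> 'S_r -> fterm E r d
| TZero r d : fterm E r d
| TAdd r d : fterm E r d -> fterm E r d -> fterm E r d
| TScale r d : k -> fterm E r d -> fterm E r d.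

Inductive feq (E : smodule) : forall r d, fterm E r d -> fterm E r d -> Prop :=
| feq_refl r d (x : fterm E r d) : feq x x
| feq_sym r d (x y : fterm E r d) : feq x y -> feq y x
| feq_trans r d (x y z : fterm E r d) : feq x y -> feq y z -> feq x z
| feq_comp m n r (d e f : int) (hr : (m + n = r.+1)%N) (hd : d + e = f) (i : 'I_m)
    (x x' : fterm E m d) (y y' : fterm E n e) :
    feq x x' -> feq y y' -> feq (TComp hr hd i x y) (TComp hr hd i x' y')
| feq_act r d (x x' : fterm E r d) s : feq x x' -> feq (TAct x s) (TAct x' s)
| feq_add r d (x x' y y' : fterm E r d) :
    feq x x' -> feq y y' -> feq (TAdd x y) (TAdd x' y')
| feq_scale r d a (x x' : fterm E r d) :
    feq x x' -> feq (TScale a x) (TScale a x')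
| feq_addA r d (x y z : fterm E r d) :
    feq (TAdd x (TAdd y z)) (TAdd (TAdd x y) z)
| feq_addC r d (x y : fterm E r d) : feq (TAdd x y) (TAdd y x)
| feq_add0 r d (x : fterm E r d) : feq (TAdd (TZero E r d) x) x
| feq_addN r d (x : fterm E r d) : feq (TAdd (TScale (-1) x) x) (TZero E r d)
| feq_scaleA r d a b (x : fterm E r d) :
    feq (TScale a (TScale b x)) (TScale (a * b) x)
| feq_scale1 r d (x : fterm E r d) : feq (TScale 1 x) x
| feq_scaleDr r d a (x y : fterm E r d) :
    feq (TScale a (TAdd x y)) (TAdd (TScale a x) (TScale a y))
| feq_scaleDl r d a b (x : fterm E r d) :
    feq (TScale (a + b) x) (TAdd (TScale a x) (TScale b x))
| feq_gen_lin r d a (x y : E r d) :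
    feq (TGen (a *: x + y)) (TAdd (TScale a (TGen x)) (TGen y))
| feq_gen_act r d (x : E r d) s : feq (TGen (sact x s)) (TAct (TGen x) s)
| feq_act_lin r d (s : 'S_r) a (x y : fterm E r d) :
    feq (TAct (TAdd (TScale a x) y) s)
        (TAdd (TScale a (TAct x s)) (TAct y s))
| feq_act1 r d (x : fterm E r d) : feq (TAct x 1%g) x
| feq_actM r d (x : fterm E r d) (s t : 'S_r) :
    feq (TAct (TAct x s) t) (TAct x (t * s)%g)
| feq_comp_linl m n r (d e f : int) (hr : (m + n = r.+1)%N) (hd : d + e = f)
    (i : 'I_m) a (x y : fterm E m d) (z : fterm E n e) :
    feq (TComp hr hd i (TAdd (TScale a x) y) z)
        (TAdd (TScale a (TComp hr hd i x z)) (TComp hr hd i y z))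
| feq_comp_linr m n r (d e f : int) (hr : (m + n = r.+1)%N) (hd : d + e = f)
    (i : 'I_m) a (x : fterm E m d) (y z : fterm E n e) :
    feq (TComp hr hd i x (TAdd (TScale a y) z))
        (TAdd (TScale a (TComp hr hd i x y)) (TComp hr hd i x z))
| feq_idl n (d : int) (hr : (1 + n = n.+1)%N) (hd : 0 + d = d) (i : 'I_1)
    (x : fterm E n d) : feq (TComp hr hd i (TId E) x) x
| feq_idr m (d : int) (hr : (m + 1 = m.+1)%N) (hd : d + 0 = d) (i : 'I_m)
    (x : fterm E m d) : feq (TComp hr hd i x (TId E)) x
| feq_seq l m n p q r (d e f g h c : int)
    (hp : (l + m = p.+1)%N) (hr : (p + n = r.+1)%N)
    (hq : (m + n = q.+1)%N) (hr' : (l + q = r.+1)%N)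
    (hg : d + e = g) (hc : g + f = c) (hh : e + f = h) (hc' : d + h = c)
    (i : 'I_l) (j : 'I_m)
    (x : fterm E l d) (y : fterm E m e) (z : fterm E n f) :
    feq (TComp hr hc (inner_pos hp i j) (TComp hp hg i x y) z)
        (TComp hr' hc' i x (TComp hq hh j y z))
| feq_par l m n p q r (d e f g h c : int)
    (hp : (l + m = p.+1)%N) (hr : (p + n = r.+1)%N)
    (hq : (l + n = q.+1)%N) (hr' : (q + m = r.+1)%N)
    (hg : d + e = g) (hc : g + f = c) (hh : d + f = h) (hc' : h + e = c)
    (i j : 'I_l) (i' j' : 'I_l.-1)
    (x : fterm E l d) (y : fterm E m e) (z : fterm E n f) :
    lift i j' = j -> lift j i' = i ->
    feq (TComp hr hc (outer_pos hp i j') (TComp hp hg i x y) z)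
        (TScale (sgn (e * f))
           (TComp hr' hc' (outer_pos hq j i') (TComp hq hh j x z) y))
| feq_actl m n r (d e f : int) (hr : (m + n = r.+1)%N) (hd : d + e = f)
    (i : 'I_m) (x : fterm E m d) (y : fterm E n e) (s : 'S_m) (t : 'S_r) :
    (forall q, t (inner_pos hr i q) = inner_pos hr (s i) q) ->
    (forall j j', s (lift i j) = lift (s i) j' ->
       t (outer_pos hr i j) = outer_pos hr (s i) j') ->
    feq (TComp hr hd i (TAct x s) y) (TAct (TComp hr hd (s i) x y) t)
| feq_actr m n r (d e f : int) (hr : (m + n = r.+1)%N) (hd : d + e = f)
    (i : 'I_m) (x : fterm E m d) (y : fterm E n e) (s : 'S_n) (t : 'S_r) :
    (forall q, t (inner_pos hr i q) = inner_pos hr i (s q)) ->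
    (forall j, t (outer_pos hr i j) = outer_pos hr i j) ->
    feq (TComp hr hd i x (TAct y s)) (TAct (TComp hr hd i x y) t).

Section Free.
Context (E : smodule).

HB.instance Definition _ r d := gen_eqMixin (fterm E r d).
HB.instance Definition _ r d := gen_choiceMixin (fterm E r d).

Definition feqb r d (x y : fterm E r d) : bool := `[< feq x y >].
Lemma feqb_equiv r d : equiv_class_of (@feqb r d).
Proof.
split=> [x|x y|y x z]; first by apply/asboolP; exact: feq_refl.
  by apply/asboolP/asboolP; exact: feq_sym.
by move=> /asboolP h1 /asboolP h2; apply/asboolP; exact: feq_trans h1 h2.
Qed.
Canonical feqb_equivRel r d := EquivRelPack (@feqb_equiv r d).

Definition free_car r d : Type := {eq_quot (@feqb r d)}.
HB.instance Definition _ r d := Choice.on (free_car r d).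

Fact fcls_key : unit. Proof. by []. Qed.
Definition fcls r d (x : fterm E r d) : free_car r d :=
  locked_with fcls_key (\pi_({eq_quot (@feqb r d)}) x).
Definition frep r d (q : free_car r d) : fterm E r d :=
  @generic_quotient.repr _ {eq_quot (@feqb r d)} q.

Lemma fclsP r d (x y : fterm E r d) : fcls x = fcls y <-> feq x y.
Proof.
rewrite /fcls !locked_withE; split=> [/eqmodP/asboolP //|h].
by apply/eqmodP/asboolP.
Qed.
Lemma frepK r d (q : free_car r d) : fcls (frep q) = q.
Proof. by rewrite /fcls locked_withE; exact: (@reprK _ {eq_quot (@feqb r d)}). Qed.
Lemma frep_eq r d (x : fterm E r d) : feq (frep (fcls x)) x.
Proof. by apply/fclsP; rewrite frepK. Qed.

Definition fadd r d (x y : free_car r d) : free_car r d :=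
  locked_with fcls_key (fcls (TAdd (frep x) (frep y))).
Definition fscale r d a (x : free_car r d) : free_car r d :=
  locked_with fcls_key (fcls (TScale a (frep x))).
Definition fcomp m n r (d e f : int) (hr : (m + n = r.+1)%N) (hd : d + e = f) i
    (x : free_car m d) (y : free_car n e) : free_car r f :=
  locked_with fcls_key (fcls (TComp hr hd i (frep x) (frep y))).
Definition ftact r d (x : free_car r d) (s : 'S_r) : free_car r d :=
  locked_with fcls_key (fcls (TAct (frep x) s)).

Lemma fadd_cls r d (x y : fterm E r d) :
  fadd (fcls x) (fcls y) = fcls (TAdd x y).
Proof. by rewrite /fadd locked_withE; apply/fclsP/feq_add; exact: frep_eq. Qed.
Lemma fscale_cls r d a (x : fterm E r d) :
  fscale a (fcls x) = fcls (TScale a x).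
Proof. by rewrite /fscale locked_withE; apply/fclsP/feq_scale/frep_eq. Qed.
Lemma fcomp_cls m n r (d e f : int) (hr : (m + n = r.+1)%N) (hd : d + e = f) i
    (x : fterm E m d) (y : fterm E n e) :
  fcomp hr hd i (fcls x) (fcls y) = fcls (TComp hr hd i x y).
Proof. by rewrite /fcomp locked_withE; apply/fclsP/feq_comp; exact: frep_eq. Qed.
Lemma ftact_cls r d (x : fterm E r d) s : ftact (fcls x) s = fcls (TAct x s).
Proof. by rewrite /ftact locked_withE; apply/fclsP/feq_act/frep_eq. Qed.

Definition fcE := (fadd_cls, fscale_cls, fcomp_cls, ftact_cls).

Lemma faddA r d : associative (@fadd r d).
Proof.
move=> x y z; rewrite -(frepK x) -(frepK y) -(frepK z) !fcE.
exact/fclsP/feq_addA.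
Qed.
Lemma faddC r d : commutative (@fadd r d).
Proof.
move=> x y; rewrite -(frepK x) -(frepK y) !fcE; exact/fclsP/feq_addC.
Qed.
Lemma fadd0 r d : left_id (fcls (TZero E r d)) (@fadd r d).
Proof. move=> x; rewrite -(frepK x) !fcE; exact/fclsP/feq_add0. Qed.
Lemma faddN r d : left_inverse (fcls (TZero E r d)) (fscale (-1)) (@fadd r d).
Proof. move=> x; rewrite -(frepK x) !fcE; exact/fclsP/feq_addN. Qed.
HB.instance Definition _ r d :=
  GRing.isZmodule.Build (free_car r d)
    (@faddA r d) (@faddC r d) (@fadd0 r d) (@faddN r d).

Lemma fscaleA r d a b (x : free_car r d) :
  fscale a (fscale b x) = fscale (a * b) x.
Proof. rewrite -(frepK x) !fcE; exact/fclsP/feq_scaleA. Qed.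
Lemma fscale1 r d : left_id 1 (@fscale r d).
Proof. move=> x; rewrite -(frepK x) !fcE; exact/fclsP/feq_scale1. Qed.
Lemma fscaleDr r d : right_distributive (@fscale r d) +%R.
Proof.
move=> a x y; change (fscale a (fadd x y) = fadd (fscale a x) (fscale a y)).
rewrite -(frepK x) -(frepK y) !fcE; exact/fclsP/feq_scaleDr.
Qed.
Lemma fscaleDl r d (x : free_car r d) :
  {morph (@fscale r d)^~ x : a b / a + b}.
Proof.
move=> a b /=; change (fscale (a + b) x = fadd (fscale a x) (fscale b x)).
rewrite -(frepK x) !fcE; exact/fclsP/feq_scaleDl.
Qed.
HB.instance Definition _ r d :=
  GRing.Zmodule_isLmodule.Build k (free_car r d)
    (@fscaleA r d) (@fscale1 r d) (@fscaleDr r d) (@fscaleDl r d).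

Lemma free_addE r d (x y : fterm E r d) : fcls x + fcls y = fcls (TAdd x y).
Proof. exact: fadd_cls. Qed.
Lemma free_scaleE r d a (x : fterm E r d) : a *: fcls x = fcls (TScale a x).
Proof. exact: fscale_cls. Qed.
Definition freeE := (free_addE, free_scaleE, fcomp_cls, ftact_cls).

Program Definition free_smodule : smodule :=
  @SModule (fun r d => free_car r d : lmodType k) ftact _ _ _.
Next Obligation.
rewrite -(frepK x) -(frepK y) !freeE; exact/fclsP/feq_act_lin.
Qed.
Next Obligation. rewrite -(frepK x) !freeE; exact/fclsP/feq_act1. Qed.
Next Obligation. rewrite -(frepK x) !freeE; exact/fclsP/feq_actM. Qed.

Program Definition free_operad : operad :=
  @Operad free_smodule (fcls (TId E)) fcomp _ _ _ _ _ _ _ _.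
Next Obligation.
rewrite -(frepK x) -(frepK y) -(frepK z) !freeE; exact/fclsP/feq_comp_linl.
Qed.
Next Obligation.
rewrite -(frepK x) -(frepK y) -(frepK z) !freeE; exact/fclsP/feq_comp_linr.
Qed.
Next Obligation. rewrite -(frepK x) !freeE; exact/fclsP/feq_idl. Qed.
Next Obligation. rewrite -(frepK x) !freeE; exact/fclsP/feq_idr. Qed.
Next Obligation.
rewrite -(frepK x) -(frepK y) -(frepK z) !freeE; exact/fclsP/feq_seq.
Qed.
Next Obligation.
rewrite -(frepK x) -(frepK y) -(frepK z) !freeE; exact/fclsP/feq_par.
Qed.
Next Obligation.
rewrite -(frepK x) -(frepK y) !freeE; apply/fclsP; exact: feq_actl.
Qed.
Next Obligation.
rewrite -(frepK x) -(frepK y) !freeE; apply/fclsP; exact: feq_actr.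
Qed.

Definition fgen r d (x : E r d) : free_operad r d := fcls (TGen x).

End Free.
End Operads.

Section Quadratic.
Context (k : fieldType).

Record subsmodule (M : smodule k) := SubSModule {
  ssm :> forall r d, submodule (M r d);
  ssm_act : forall r d (x : M r d) (s : 'S_r), ssm r d x -> ssm r d (sact x s) }.

Record ideal (O : operad k) := Ideal {
  iss :> subsmodule O;
  ideal_compl : forall m n r (d e f : int) (hr : (m + n = r.+1)%N)
      (hd : d + e = f) (i : 'I_m) (x : O m d) (y : O n e),
    iss m d x -> iss r f (ocomp hr hd i x y);
  ideal_compr : forall m n r (d e f : int) (hr : (m + n = r.+1)%N)
      (hd : d + e = f) (i : 'I_m) (x : O m d) (y : O n e),
    iss n e y -> iss r f (ocomp hr hd i x y) }.

Section OperadLemmas.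
Context (O : operad k).

Lemma sactB r d (x y : O r d) (s : 'S_r) : sact (x - y) s = sact x s - sact y s.
Proof. by rewrite addrC -scaleN1r sact_lin scaleN1r addrC. Qed.
Lemma ocompBl m n r (d e f : int) (hr : (m + n = r.+1)%N) (hd : d + e = f)
    (i : 'I_m) (x y : O m d) (z : O n e) :
  ocomp hr hd i (x - y) z = ocomp hr hd i x z - ocomp hr hd i y z.
Proof. by rewrite addrC -scaleN1r ocomp_linl scaleN1r addrC. Qed.
Lemma ocompBr m n r (d e f : int) (hr : (m + n = r.+1)%N) (hd : d + e = f)
    (i : 'I_m) (x : O m d) (y z : O n e) :
  ocomp hr hd i x (y - z) = ocomp hr hd i x y - ocomp hr hd i x z.
Proof. by rewrite addrC -scaleN1r ocomp_linr scaleN1r addrC. Qed.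

Lemma submoduleD (V : lmodType k) (S : submodule V) u v :
  S u -> S v -> S (u + v).
Proof. by rewrite -{2}(scale1r u); exact: smemL. Qed.

Context (I : ideal O).

Definition qcar r d : lmodType k := mquot (I r d).
Definition qact r d (x : qcar r d) (s : 'S_r) : qcar r d :=
  locked_with fcls_key (mcls (I r d) (sact (mrepr x) s)).
Definition qcomp m n r (d e f : int) (hr : (m + n = r.+1)%N) (hd : d + e = f) i
    (x : qcar m d) (y : qcar n e) : qcar r f :=
  locked_with fcls_key (mcls (I r f) (ocomp hr hd i (mrepr x) (mrepr y))).

Lemma qact_pi r d (x : O r d) s :
  qact (mcls (I r d) x) s = mcls (I r d) (sact x s).
Proof.
rewrite /qact locked_withE; apply/mcls_eq; rewrite -sactB.
by apply/ssm_act/mcls_eq; rewrite mcls_repr.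
Qed.
Lemma qcomp_pi m n r (d e f : int) (hr : (m + n = r.+1)%N) (hd : d + e = f) i
    (x : O m d) (y : O n e) :
  qcomp hr hd i (mcls (I m d) x) (mcls (I n e) y)
  = mcls (I r f) (ocomp hr hd i x y).
Proof.
rewrite /qcomp locked_withE; apply/mcls_eq.
set x' := mrepr _; set y' := mrepr _.
rewrite -[X in X - _](subrK (ocomp hr hd i x y')) -addrA -ocompBl -ocompBr.
apply: submoduleD.
  by apply/ideal_compl/mcls_eq; rewrite mcls_repr.
by apply/ideal_compr/mcls_eq; rewrite mcls_repr.
Qed.

Let mcls_lin r d a (x y : O r d) :
  a *: mcls (I r d) x + mcls (I r d) y = mcls (I r d) (a *: x + y).
Proof. by rewrite mcls_linear. Qed.
Let mcls_scale r d a (x : O r d) :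
  a *: mcls (I r d) x = mcls (I r d) (a *: x).
Proof. by rewrite linearZ. Qed.
Let mrK r d (x : qcar r d) : mcls (I r d) (mrepr x) = x.
Proof. exact: mcls_repr. Qed.

Program Definition quot_smodule : smodule k := @SModule k qcar qact _ _ _.
Next Obligation.
by rewrite -(mrK x) -(mrK y) mcls_lin !qact_pi sact_lin mcls_lin.
Qed.
Next Obligation. by rewrite -(mrK x) qact_pi sact1. Qed.
Next Obligation. by rewrite -(mrK x) !qact_pi sactM. Qed.

Program Definition quot_operad : operad k :=
  @Operad k quot_smodule (mcls (I 1%N 0) (oid O)) qcomp _ _ _ _ _ _ _ _.
Next Obligation.
by rewrite -(mrK x) -(mrK y) -(mrK z) mcls_lin !qcomp_pi ocomp_linl mcls_lin.
Qed.
Next Obligation.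
by rewrite -(mrK x) -(mrK y) -(mrK z) mcls_lin !qcomp_pi ocomp_linr mcls_lin.
Qed.
Next Obligation. by rewrite -(mrK x) qcomp_pi ocomp_idl. Qed.
Next Obligation. by rewrite -(mrK x) qcomp_pi ocomp_idr. Qed.
Next Obligation.
rewrite -(mrK x) -(mrK y) -(mrK z) !qcomp_pi; congr mcls; exact: ocomp_seq.
Qed.
Next Obligation.
rewrite -(mrK x) -(mrK y) -(mrK z) !qcomp_pi mcls_scale; congr mcls.
exact: ocomp_par.
Qed.
Next Obligation.
rewrite -(mrK x) -(mrK y) !qact_pi !qcomp_pi !qact_pi; congr mcls.
exact: ocomp_actl.
Qed.
Next Obligation.
rewrite -(mrK x) -(mrK y) !qact_pi !qcomp_pi !qact_pi; congr mcls.
exact: ocomp_actr.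
Qed.

End OperadLemmas.

Section Presentation.
Context (E : smodule k).

(** [fweight w x]: [x] belongs to the weight [w] part of the free operad. *)
Inductive fweight : nat -> forall r d, free_operad E r d -> Prop :=
| fweight_id : fweight 0 (oid (free_operad E))
| fweight_gen r d (x : E r d) : fweight 1 (fgen x)
| fweight_comp v w m n r (d e f : int) (hr : (m + n = r.+1)%N) (hd : d + e = f)
    (i : 'I_m) (x : free_operad E m d) (y : free_operad E n e) :
    fweight v x -> fweight w y -> fweight (v + w) (ocomp hr hd i x y)
| fweight_act w r d (x : free_operad E r d) (s : 'S_r) :
    fweight w x -> fweight w (sact x s)
| fweight_0 w r d : fweight w (0 : free_operad E r d)
| fweight_lin w r d a (x y : free_operad E r d) :
    fweight w x -> fweight w y -> fweight w (a *: x + y).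

Context (R : subsmodule (free_operad E)).

Inductive gen_ideal : forall r d, free_operad E r d -> Prop :=
| gi_rel r d (x : free_operad E r d) : R r d x -> gen_ideal x
| gi_0 r d : gen_ideal (0 : free_operad E r d)
| gi_lin r d a (x y : free_operad E r d) :
    gen_ideal x -> gen_ideal y -> gen_ideal (a *: x + y)
| gi_act r d (x : free_operad E r d) (s : 'S_r) : gen_ideal x -> gen_ideal (sact x s)
| gi_compl m n r (d e f : int) (hr : (m + n = r.+1)%N) (hd : d + e = f)
    (i : 'I_m) (x : free_operad E m d) (y : free_operad E n e) :
    gen_ideal x -> gen_ideal (ocomp hr hd i x y)
| gi_compr m n r (d e f : int) (hr : (m + n = r.+1)%N) (hd : d + e = f)
    (i : 'I_m) (x : free_operad E m d) (y : free_operad E n e) :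
    gen_ideal y -> gen_ideal (ocomp hr hd i x y).

Definition gen_subsmodule : subsmodule (free_operad E) :=
  @SubSModule _ (fun r d => Submodule (gi_0 r d) (@gi_lin r d)) (@gi_act).
Definition rel_ideal : ideal (free_operad E) :=
  @Ideal _ gen_subsmodule gi_compl gi_compr.

Definition presented : operad k := quot_operad rel_ideal.

Definition pcls r d (x : free_operad E r d) : presented r d := mcls (rel_ideal r d) x.
Definition pgen r d (x : E r d) : presented r d := pcls (fgen x).

Definition pweight w r d (p : presented r d) : Prop :=
  exists2 x : free_operad E r d, fweight w x & pcls x = p.

Lemma pweight_comp v w m n r (d e f : int) (hr : (m + n = r.+1)%N)
    (hd : d + e = f) (i : 'I_m) (x : presented m d) (y : presented n e) :
  pweight v x -> pweight w y -> pweight (v + w) (ocomp hr hd i x y).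
Proof.
move=> [x' wx <-] [y' wy <-]; exists (ocomp hr hd i x' y').
  exact: fweight_comp.
by rewrite /= /pcls qcomp_pi.
Qed.

End Presentation.
End Quadratic.

Section Koszul.
Import freeg.
Context (k : fieldType) (O : operad k).
Context (wt : nat -> forall r d, O r d -> Prop).
Context (wt_comp : forall v w m n r (d e f : int) (hr : (m + n = r.+1)%N)
  (hd : d + e = f) (i : 'I_m) (x : O m d) (y : O n e),
  wt v x -> wt w y -> wt (v + w) (ocomp hr hd i x y)).

(** Planar trees with labelled leaves, whose vertices are decorated with
    elements of positive weight. *)
Inductive tree : Type :=
| Leaf : nat -> tree
| Node n (d : int) w (x : O n d) : (0 < w)%N -> wt w x -> ('I_n -> tree) -> tree.

HB.instance Definition _ := gen_eqMixin tree.
HB.instance Definition _ := gen_choiceMixin tree.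

Fixpoint leaves (t : tree) : seq nat :=
  match t with
  | Leaf a => [:: a]
  | Node n _ _ _ _ _ c => flatten [seq leaves (c i) | i <- enum 'I_n]
  end.

Fixpoint nverts (t : tree) : nat :=
  match t with
  | Leaf _ => 0
  | Node n _ _ _ _ _ c => (\sum_(i < n) nverts (c i)).+1
  end.

Fixpoint tweight (t : tree) : nat :=
  match t with
  | Leaf _ => 0
  | Node n _ w _ _ _ c => (w + \sum_(i < n) tweight (c i))%N
  end.

(** The degree in the bar construction, in which vertices are suspended. *)
Fixpoint tdeg (t : tree) : int :=
  match t with
  | Leaf _ => 0
  | Node n d _ _ _ _ c => d + 1 + \sum_(i < n) tdeg (c i)
  end.

Definition chain : lmodType k := {freeg tree / k}.
Definition mono (t : tree) : chain := << t >>.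

Definition replace n (c : 'I_n -> tree) (i : 'I_n) (t : tree) (j : 'I_n) : tree :=
  if j == i then t else c j.

(** Chains that vanish in the cofree cooperad on the suspension of the
    augmentation ideal: decorations are multilinear and equivariant. *)
Inductive null : chain -> Prop :=
| null_0 : null 0
| null_lin a x y : null x -> null y -> null (a *: x + y)
| null_multilinear n d w (x y : O n d) a (hw hw' hw'' : (0 < w)%N)
    (hx : wt w x) (hy : wt w y) (hxy : wt w (a *: x + y)) c :
    null (mono (Node hw'' hxy c) - (a *: mono (Node hw hx c) + mono (Node hw' hy c)))
| null_equivariant n d w (x : O n d) (s : 'S_n) (hw hw' : (0 < w)%N)
    (hx : wt w x) (hxs : wt w (sact x s)) (c : 'I_n -> tree) :
    null (mono (Node hw' hxs c)
          - sgn k (\sum_(i < n) \sum_(j < n | (i < j)%N && (s j < s i)%N)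
                     tdeg (c i) * tdeg (c j))
            *: mono (Node hw hx (fun i => c ((s^-1)%g i))))
| null_node n d w (x : O n d) (hw : (0 < w)%N) (hx : wt w x) c (i : 'I_n) z :
    null z -> null (fglift (fun t => mono (Node hw hx (replace c i t))) z).

(** The children of the vertex obtained by contracting the edge between a
    vertex with children [c] and its [i]-th child, which has children [c']
    (the default value is never used: every position is inner or outer). *)
Definition merge_children m n r (hr : (m + n = r.+1)%N) (i : 'I_m)
    (c : 'I_m -> tree) (c' : 'I_n -> tree) (p : 'I_r) : tree :=
  if [pick q | inner_pos hr i q == p] is Some q then c' q
  else if [pick j | outer_pos hr i j == p] is Some j then c (fintype.lift i j)
  else Leaf 0.

Lemma contract_arity m n (i : 'I_m) : (m + n = (m.-1 + n).+1)%N.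
Proof. by case: m i => [[]|]. Qed.

Lemma contract_wt v w m n (d e : int) (i : 'I_m) (x : O m d) (y : O n e)
    (hx : wt v x) (hy : wt w y) :
  wt (v + w) (ocomp (contract_arity n i) (erefl (d + e)) i x y).
Proof. exact: wt_comp. Qed.

Lemma contract_gt0 v w : (0 < v -> 0 < w -> 0 < v + w)%N.
Proof. by rewrite addn_gt0 => ->. Qed.

Definition contract m (d : int) v (x : O m d) (hv : (0 < v)%N) (hx : wt v x)
    (c : 'I_m -> tree) (i : 'I_m) : chain :=
  match c i with
  | Leaf _ => 0
  | Node n e w y hw hy c' =>
      sgn k ((e + 1) * \sum_(j < m | (j < i)%N) tdeg (c j) + d)
      *: mono (Node (contract_gt0 hv hw) (contract_wt i hx hy)
                    (merge_children (contract_arity n i) i c c'))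
  end.

(** The bar differential contracts the internal edges one by one.  The signs
    are those of [s x (x) s y |-> (-1)^|x| s (x o y)], applied after reading
    the vertices in the order: root, then subtrees from left to right. *)
Fixpoint dtree (t : tree) : chain :=
  match t with
  | Leaf _ => 0
  | Node n d w x hw hx c =>
      \sum_(i < n)
        (contract hw hx c i
         + sgn k (d + 1 + \sum_(j < n | (j < i)%N) tdeg (c j))
           *: fglift (fun t => mono (Node hw hx (replace c i t))) (dtree (c i)))
  end.

Definition dbar : chain -> chain := fglift dtree.

Definition bar s v r (z : chain) : Prop :=
  forall t, t \in dom z ->
    [/\ tweight t = s, nverts t = v & perm_eq (leaves t) (iota 0 r)].

(** The bar complex of [O] in weight [s], arity [r] and with [v] vertices is
    [bar s v r] modulo [null].  Its homology on the diagonal [v = s] is the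
    Koszul dual cooperad; [O] is Koszul when the inclusion of the latter into
    the bar construction is a quasi-isomorphism, that is, when the homology
    vanishes off the diagonal. *)
Definition bar_koszul : Prop :=
  forall s v r, v <> s ->
  forall z, bar s v r z -> null (dbar z) ->
  exists2 b, bar s v.+1 r b & null (z - dbar b).

End Koszul.

Definition koszul (k : fieldType) (E : smodule k) (R : subsmodule (free_operad E)) : Prop :=
  bar_koszul (@pweight_comp k E R).

Section Homogeneous.
Context (k : fieldType) (A : int -> lmodType k).

Definition hel : Type := {n : int & A n}.
Definition hom n (a : A n) : hel := existT (fun n => A n : Type) n a.

Lemma hom_inj n : injective (@hom n).
Proof.
move=> a b e; have := congr1 (fun x : hel =>
  if eqP is ReflectT h then eq_rect _ (fun n => A n : Type) (tagged x) n h else a) e.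
rewrite /=; case: eqP => // h; by rewrite (eq_irrelevance h erefl).
Qed.

End Homogeneous.

Section Algebras.
Context (k : fieldType) (O : operad k).

(** The operation [alg_act mu x], i.e. [mu (x_1, ..., x_r)], is given in
    degree [n] for each [n] equal to [|mu| + |x_1| + ... + |x_r|]. *)
Record dgalg := DGAlg {
  acar :> int -> lmodType k;
  diff : forall n m : int, m + 1 = n -> {linear acar n -> acar m};
  diff_diff : forall (n m p : int) (h : m + 1 = n) (h' : p + 1 = m) (a : acar n),
    diff h' (diff h a) = 0;
  alg_act : forall r e, O r e -> forall (x : 'I_r -> hel acar) (n : int),
    e + \sum_i tag (x i) = n -> acar n;
  alg_linl : forall r e a (mu nu : O r e) (x : 'I_r -> hel acar) (n : int)
      (h : e + \sum_i tag (x i) = n),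
    alg_act (a *: mu + nu) h = a *: alg_act mu h + alg_act nu h;
  alg_linr : forall r e (mu : O r e) (i : 'I_r) p a (u v : acar p)
      (x y z : 'I_r -> hel acar) (n : int)
      (hx : e + \sum_i tag (x i) = n) (hy : e + \sum_i tag (y i) = n)
      (hz : e + \sum_i tag (z i) = n),
    x i = hom (a *: u + v) -> y i = hom u -> z i = hom v ->
    (forall j : 'I_r, j != i -> y j = x j /\ z j = x j) ->
    alg_act mu hx = a *: alg_act mu hy + alg_act mu hz;
  alg_id : forall (x : 'I_1 -> hel acar)
      (h : 0 + \sum_i tag (x i) = tag (x ord0)),
    alg_act (oid O) h = tagged (x ord0);
  alg_perm : forall r e (mu : O r e) (s : 'S_r) (x : 'I_r -> hel acar) (n : int)
      (h : e + \sum_i tag (x i) = n)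
      (h' : e + \sum_i tag (x ((s^-1)%g i)) = n),
    alg_act (sact mu s) h
    = sgn k (\sum_(i < r) \sum_(j < r | (i < j)%N && (s j < s i)%N)
               tag (x i) * tag (x j))
      *: alg_act mu h';
  alg_comp : forall p q r (d e f : int) (hr : (p + q = r.+1)%N) (hd : d + e = f)
      (i : 'I_p) (mu : O p d) (nu : O q e) (x : 'I_r -> hel acar) (n l : int)
      (h : f + \sum_j tag (x j) = n)
      (hl : e + \sum_j tag (x (inner_pos hr i j)) = l)
      (h' : d + \sum_j tag (graft hr i x (hom (alg_act nu hl)) j) = n),
    alg_act (ocomp hr hd i mu nu) h
    = sgn k (e * \sum_(j < r | (j < i)%N) tag (x j)) *: alg_act mu h';
  alg_leibniz : forall r e (mu : O r e) (x : 'I_r -> hel acar) (n m : int)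
      (hm : m + 1 = n) (h : e + \sum_i tag (x i) = n)
      (h' : forall i, e + \sum_j tag (if j == i
              then hom (diff (subrK 1 (tag (x i))) (tagged (x i))) else x j) = m),
    diff hm (alg_act mu h)
    = \sum_(i < r) sgn k (e + \sum_(j < r | (j < i)%N) tag (x j))
             *: alg_act mu (h' i) }.

#[global] Arguments alg_act _ {r e} _ {x n} _.

Section Homology.
Context (A : dgalg).

Lemma cyc_subproof n a (u v : A n) :
  diff A (subrK 1 n) u = 0 -> diff A (subrK 1 n) v = 0 ->
  diff A (subrK 1 n) (a *: u + v) = 0.
Proof. by move=> hu hv; rewrite linearP hu hv scaler0 addr0. Qed.
Definition cyc n : submodule (A n) :=
  @Submodule _ _ (fun a : A n => diff A (subrK 1 n) a = 0)
    (linear0 _) (@cyc_subproof n).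

Definition is_bnd n (z : sub_of (cyc n)) : Prop :=
  exists b : A (n + 1), diff A erefl b = \val z.
Lemma is_bnd0 n : is_bnd (0 : sub_of (cyc n)).
Proof. by exists 0; rewrite linear0. Qed.
Lemma is_bndL n a (u v : sub_of (cyc n)) :
  is_bnd u -> is_bnd v -> is_bnd (a *: u + v).
Proof. by move=> [b hb] [c hc]; exists (a *: b + c); rewrite linearP hb hc. Qed.
Definition bnd n : submodule (sub_of (cyc n)) := Submodule (@is_bnd0 n) (@is_bndL n).

Definition homology n : lmodType k := mquot (bnd n).

Definition hcls n (z : sub_of (cyc n)) : homology n := mcls (bnd n) z.

Lemma cycP n m (h : m + 1 = n) (a : A n) : cyc n a <-> diff A h a = 0.
Proof.
have e : m = n - 1 by rewrite -h addrK.
by subst m; rewrite /= (eq_irrelevance h (subrK 1 n)).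
Qed.

Lemma leibniz_deg (r : nat) (e : int) (x : 'I_r -> hel A) n m (hm : m + 1 = n)
    (h : e + \sum_i tag (x i) = n) i :
  e + \sum_j tag (if j == i
      then hom (diff A (subrK 1 (tag (x i))) (tagged (x i))) else x j) = m.
Proof.
apply: (addIr 1); rewrite hm -h [in RHS](bigD1 i) //= (bigD1 i) //= eqxx /=.
have -> : \sum_(j < r | j != i) tag (if j == i
   then hom (diff A (subrK 1 (tag (x i))) (tagged (x i))) else x j)
   = \sum_(j < r | j != i) tag (x j).
  by apply: eq_bigr => j /negbTE ->.
by rewrite [tag (x i) - 1 + _]addrAC [e + (_ - 1)]addrA subrK.
Qed.


Lemma act_irr r e (mu : O r e) (x y : 'I_r -> hel A) n
    (h : e + \sum_i tag (x i) = n) (h' : e + \sum_i tag (y i) = n) :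
  x = y -> alg_act A mu h = alg_act A mu h'.
Proof. by move=> exy; subst y; rewrite (eq_irrelevance h h'). Qed.

Lemma act_zero r e (mu : O r e) (x : 'I_r -> hel A) n
    (h : e + \sum_i tag (x i) = n) i p :
  x i = hom (0 : A p) -> alg_act A mu h = 0.
Proof.
move=> xi; have h0 : x i = hom ((1 : k) *: 0 + 0 : A p) by rewrite scaler0 addr0.
have := @alg_linr A r e mu i p 1 0 0 x x x n h h h h0 xi xi.
by move=> /(_ (fun _ _ => conj erefl erefl)) /eqP; rewrite scale1r addrC -subr_eq subrr eq_sym => /eqP.
Qed.

Definition is_cyc (a : hel A) := cyc (tag a) (tagged a).

Lemma act_cyc r e (mu : O r e) (x : 'I_r -> hel A) (n : int)
    (h : e + \sum_i tag (x i) = n) :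
  (forall i, is_cyc (x i)) -> cyc n (alg_act A mu h).
Proof.
move=> cx /=.
rewrite (@alg_leibniz A r e mu x n _ (subrK 1 n) h (leibniz_deg (subrK 1 n) h)).
apply: big1 => i _; rewrite (@act_zero _ _ _ _ _ _ i (tag (x i) - 1)) ?scaler0 //.
by rewrite eqxx (cx i).
Qed.

Lemma act_bnd r e (mu : O r e) (x : 'I_r -> hel A) (n : int)
    (h : e + \sum_i tag (x i) = n) i p (b : A (p + 1)) :
  (forall i, is_cyc (x i)) -> x i = hom (diff A erefl b) ->
  exists c : A (n + 1), diff A erefl c = alg_act A mu h.
Proof.
move=> cx xi.
pose y j := if j == i then hom b else x j.
have hy : e + \sum_j tag (y j) = n + 1.
  rewrite -h (bigD1 i) //= [in RHS](bigD1 i) //= /y eqxx xi /=.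
  have -> : \sum_(j < r | j != i) tag (if j == i then hom b else x j)
          = \sum_(j < r | j != i) tag (x j).
    by apply: eq_bigr => j /negbTE ->.
  by rewrite [p + 1 + _]addrAC addrA.
pose s : k := sgn k (e + \sum_(j < r | (j < i)%N) tag (y j)).
have s2 : s * s = 1.
  by rewrite /s /sgn -expfzMl mulrNN mulr1 exp1rz.
exists (s *: alg_act A mu hy); rewrite linearZ /=.
rewrite (@alg_leibniz A r e mu y _ _ erefl hy (leibniz_deg erefl hy)).
rewrite (bigD1 i) //= [X in _ *: (_ + X)]big1 ?addr0 => [|j ji].
  rewrite scalerA -/s s2 scale1r; apply: act_irr; apply/funext => j.
  case: eqVneq => [->|ji]; last by rewrite /y (negbTE ji).
  rewrite xi; have -> : y i = hom b by rewrite /y eqxx.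
  have aux (q : int) (hq : q + 1 = p + 1) : hom (diff A hq b) = hom (diff A erefl b).
    by have e' := addIr _ hq; subst q; rewrite (eq_irrelevance hq erefl).
  exact: aux.
rewrite (@act_zero _ _ _ _ _ _ j (tag (y j) - 1)) ?scaler0 //.
rewrite eqxx; have -> : y j = x j by rewrite /y (negbTE ji).
by rewrite (cx j).
Qed.

Definition heq (a b : hel A) := exists n (u v : sub_of (cyc n)),
  [/\ a = hom (\val u), b = hom (\val v) & hcls u = hcls v].

Lemma heq_refl a : is_cyc a -> heq a a.
Proof.
by case: a => n a ca; exists n, (to_sub ca), (to_sub ca); split.
Qed.

Lemma heq_deg a b : heq a b -> tag a = tag b.
Proof. by case=> n [u [v [-> -> _]]]. Qed.

Lemma heq_cyc a b : heq a b -> is_cyc a /\ is_cyc b.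
Proof.
by case=> n [u [v [-> -> _]]]; split; exact: sub_ofP.
Qed.

Lemma act_heq1 r e (mu : O r e) (x y : 'I_r -> hel A) (n : int)
    (hx : e + \sum_i tag (x i) = n) (hy : e + \sum_i tag (y i) = n) i :
  (forall j, is_cyc (x j)) -> heq (x i) (y i) ->
  (forall j, j != i -> y j = x j) ->
  exists c : A (n + 1), diff A erefl c = alg_act A mu hx - alg_act A mu hy.
Proof.
move=> cx [p [u [v [xi yi /mcls_eq [b hb]]]]] yx.
have hb' : diff A erefl b = \val u - \val v by rewrite hb raddfB.
pose w j := if j == i then hom (diff A erefl b) else x j.
have hw : e + \sum_j tag (w j) = n.
  rewrite -hx; congr (_ + _); apply: eq_bigr => j _; rewrite /w.
  by case: eqP => // ->; rewrite xi.
have wi : w i = hom (diff A erefl b) by rewrite /w eqxx.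
have cw j : is_cyc (w j).
  rewrite /w; case: eqP => // _.
  rewrite /is_cyc /=; exact: diff_diff.
have [c hc] := act_bnd mu hw cw wi.
exists c; rewrite hc.
rewrite (@alg_linr A r e mu i p (-1) (\val v) (\val u) w y x n hw hy hx) //.
- by rewrite scaleN1r addrC.
- by rewrite wi hb' scaleN1r addrC.
by move=> j ji; rewrite /w (negbTE ji) yx.
Qed.

Lemma act_heq r e (mu : O r e) (x y : 'I_r -> hel A) (n : int)
    (hx : e + \sum_i tag (x i) = n) (hy : e + \sum_i tag (y i) = n) :
  (forall j, heq (x j) (y j)) ->
  exists c : A (n + 1), diff A erefl c = alg_act A mu hx - alg_act A mu hy.
Proof.
move=> xy; pose z (m : nat) (j : 'I_r) := if (j < m)%N then y j else x j.
have tz m j : tag (z m j) = tag (x j).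
  by rewrite /z; case: ifP => // _; rewrite (heq_deg (xy j)).
have hz m : e + \sum_j tag (z m j) = n.
  by rewrite -hx; congr (_ + _); apply: eq_bigr.
have cz m j : is_cyc (z m j).
  by rewrite /z; case: ifP => _; case: (heq_cyc (xy j)).
have main m : exists c : A (n + 1),
    diff A erefl c = alg_act A mu hx - alg_act A mu (hz m).
  elim: m => [|m [c hc]].
    exists 0; rewrite linear0; apply/esym/eqP; rewrite subr_eq0; apply/eqP.
    by apply: act_irr; apply/funext => j; rewrite /z ltn0.
  have [ltmr|lerm] := ltnP m r; last first.
    exists c; rewrite hc; congr (_ - _); apply: act_irr; apply/funext => j.
    by rewrite /z !(leq_trans (ltn_ord j)) // (leq_trans lerm).
  pose i := Ordinal ltmr.
  have [|j ji|c' hc'] := @act_heq1 r e mu (z m) (z m.+1) n (hz m) (hz m.+1) i (cz m).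
  - by rewrite /z /= ltnn ltnSn; exact: xy.
  - rewrite /z ltnS leq_eqVlt; case: eqP => //= ejm.
    by case/eqP: ji; apply: val_inj.
  exists (c + c'); rewrite linearD /= hc hc' addrA subrK //.
have [c hc] := main r; exists c; rewrite hc; congr (_ - _).
by apply: act_irr; apply/funext => j; rewrite /z ltn_ord.
Qed.

Definition hrep (q : hel homology) : hel A := hom (\val (mrepr (tagged q))).

Lemma hrep_cyc q : is_cyc (hrep q).
Proof. exact: sub_ofP. Qed.

Lemma hrep_heq n (z : sub_of (cyc n)) : heq (hrep (hom (hcls z))) (hom (\val z)).
Proof. by exists n, (mrepr (hcls z)), z; split => //; exact: mcls_repr. Qed.

Definition hact r e (mu : O r e) (x : 'I_r -> hel homology) n
    (h : e + \sum_i tag (x i) = n) : homology n :=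
  hcls (to_sub (@act_cyc r e mu (fun i => hrep (x i)) n h
                  (fun i => hrep_cyc (x i)))).

Lemma hactE r e (mu : O r e) (x : 'I_r -> hel homology) (y : 'I_r -> hel A) n
    (h : e + \sum_i tag (x i) = n) (h' : e + \sum_i tag (y i) = n)
    (hc : cyc n (alg_act A mu h')) :
  (forall i, heq (hrep (x i)) (y i)) -> hact mu h = hcls (to_sub hc).
Proof.
move=> xy; apply/mcls_eq.
have [c hc'] := @act_heq r e mu (fun i => hrep (x i)) y n h h' xy.
by exists c; rewrite hc'.
Qed.

Definition hdiff n m (_ : m + 1 = n) : {linear homology n -> homology m} := \0.

Lemma hdiff_diff n m p (h : m + 1 = n) (h' : p + 1 = m) (a : homology n) :
  hdiff h' (hdiff h a) = 0.
Proof. by []. Qed.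

Lemma hact_linl r e a (mu nu : O r e) (x : 'I_r -> hel homology) (n : int)
    (h : e + \sum_i tag (x i) = n) :
  hact (a *: mu + nu) h = a *: hact mu h + hact nu h.
Proof.
rewrite /hact /hcls -linearP; congr mcls; apply: val_inj.
by rewrite linearP /= alg_linl.
Qed.

Lemma hrep_hom n (q : homology n) : heq (hrep (hom q)) (hom (\val (mrepr q))).
Proof. by exists n, (mrepr q), (mrepr q). Qed.

Lemma hact_linr r e (mu : O r e) (i : 'I_r) p a (u v : homology p)
    (x y z : 'I_r -> hel homology) (n : int)
    (hx : e + \sum_i tag (x i) = n) (hy : e + \sum_i tag (y i) = n)
    (hz : e + \sum_i tag (z i) = n) :
  x i = hom (a *: u + v) -> y i = hom u -> z i = hom v ->
  (forall j : 'I_r, j != i -> y j = x j /\ z j = x j) ->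
  hact mu hx = a *: hact mu hy + hact mu hz.
Proof.
move=> xi yi zi yzx; rewrite {2 3}/hact /hcls -linearP.
pose w j := if j == i then hom (\val (a *: mrepr u + mrepr v)) else hrep (x j).
have hw : e + \sum_j tag (w j) = n.
  rewrite -hx; congr (_ + _); apply: eq_bigr => j _; rewrite /w.
  by case: eqP => // ->; rewrite xi.
have cw : cyc n (alg_act A mu hw).
  apply: act_cyc => j; rewrite /w; case: ifP => _; last exact: hrep_cyc.
  exact: sub_ofP.
rewrite (@hactE r e mu x w n hx hw cw) => [|j].
  congr mcls; apply: val_inj; rewrite linearP /=.
  apply: (@alg_linr A r e mu i p a (\val (mrepr u)) (\val (mrepr v))).
  - by rewrite /w eqxx linearP.
  - by rewrite yi.
  - by rewrite zi.
  by move=> j ji; rewrite /w (negbTE ji); have [-> ->] := yzx j ji.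
rewrite /w; case: eqP => [->|_]; last by apply: heq_refl; exact: hrep_cyc.
rewrite xi; exists p, (mrepr (a *: u + v)), (a *: mrepr u + mrepr v); split=> //.
by rewrite /hcls mcls_linear !mcls_repr.
Qed.

Lemma hact_id (x : 'I_1 -> hel homology)
    (h : 0 + \sum_i tag (x i) = tag (x ord0)) :
  hact (oid O) h = tagged (x ord0).
Proof.
rewrite /hact -[RHS]mcls_repr; congr mcls; apply: val_inj => /=.
exact: (@alg_id A (fun i => hrep (x i))).
Qed.

Lemma hact_perm r e (mu : O r e) (s : 'S_r) (x : 'I_r -> hel homology) (n : int)
    (h : e + \sum_i tag (x i) = n)
    (h' : e + \sum_i tag (x ((s^-1)%g i)) = n) :
  hact (sact mu s) h
  = sgn k (\sum_(i < r) \sum_(j < r | (i < j)%N && (s j < s i)%N)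
             tag (x i) * tag (x j))
    *: hact mu h'.
Proof.
rewrite /hact /hcls -linearZ; congr mcls; apply: val_inj.
rewrite linearZ /=.
exact: (@alg_perm A r e mu s (fun i => hrep (x i)) n h h').
Qed.

Lemma hact_comp p q r (d e f : int) (hr : (p + q = r.+1)%N) (hd : d + e = f)
    (i : 'I_p) (mu : O p d) (nu : O q e) (x : 'I_r -> hel homology) (n l : int)
    (h : f + \sum_j tag (x j) = n)
    (hl : e + \sum_j tag (x (inner_pos hr i j)) = l)
    (h' : d + \sum_j tag (graft hr i x (hom (hact nu hl)) j) = n) :
  hact (ocomp hr hd i mu nu) h
  = sgn k (e * \sum_(j < r | (j < i)%N) tag (x j)) *: hact mu h'.
Proof.
pose y j := hrep (x j).
pose w := graft hr i y (hom (alg_act A nu (x := fun j => y (inner_pos hr i j)) hl)).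
have xw j : heq (hrep (graft hr i x (hom (hact nu hl)) j)) (w j).
  rewrite /w /graft; case: unlift => [j'|]; first by apply: heq_refl; exact: hrep_cyc.
  exact: hrep_heq.
have hw : d + \sum_j tag (w j) = n.
  by rewrite -h'; congr (_ + _); apply: eq_bigr => j _; rewrite -(heq_deg (xw j)).
have cw : cyc n (alg_act A mu hw).
  by apply: act_cyc => j; have [] := heq_cyc (xw j).
rewrite (@hactE p d mu _ w n h' hw cw xw) {1}/hact /hcls -linearZ; congr mcls.
apply: val_inj; rewrite linearZ /=.
exact: (@alg_comp A p q r d e f hr hd i mu nu y n l h hl hw).
Qed.

Lemma hact_leibniz r e (mu : O r e) (x : 'I_r -> hel homology) (n m : int)
    (hm : m + 1 = n) (h : e + \sum_i tag (x i) = n)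
    (h' : forall i, e + \sum_j tag (if j == i
      then hom (hdiff (subrK 1 (tag (x i))) (tagged (x i))) else x j) = m) :
  hdiff hm (hact mu h)
  = \sum_(i < r) sgn k (e + \sum_(j < r | (j < i)%N) tag (x j))
             *: hact mu (h' i).
Proof.
rewrite /hdiff big1 // => i _.
have {1}-> : (0 : homology m) = sgn k (e + \sum_(j < r | (j < i)%N) tag (x j)) *: 0.
  by rewrite scaler0.
congr (_ *: _).
pose y j := if j == i then hom (0 : homology (tag (x i) - 1)) else x j.
have yi : y i = hom ((1 : k) *: 0 + 0 : homology (tag (x i) - 1)).
  by rewrite /y eqxx scaler0 addr0.
have yi0 : y i = hom (0 : homology (tag (x i) - 1)) by rewrite /y eqxx.
have := @hact_linr r e mu i _ 1 0 0 y y y m (h' i) (h' i) (h' i) yi yi0 yi0.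
move=> /(_ (fun _ _ => conj erefl erefl)) /eqP.
by rewrite scale1r addrC -subr_eq subrr => /eqP.
Qed.

Definition halg : dgalg :=
  @DGAlg homology hdiff hdiff_diff hact hact_linl hact_linr hact_id hact_perm
    hact_comp hact_leibniz.

End Homology.

Record dgmor (A B : dgalg) := DGMor {
  mor :> forall n, {linear A n -> B n};
  mor_diff : forall (n m : int) (h : m + 1 = n) (a : A n),
    mor m (diff A h a) = diff B h (mor n a);
  mor_act : forall r e (mu : O r e) (x : 'I_r -> hel A) (n : int)
      (h : e + \sum_i tag (x i) = n),
    mor n (alg_act A mu h)
    = alg_act B mu (x := fun i => hom (mor (tag (x i)) (tagged (x i)))) h }.

Lemma mor_cyc (A B : dgalg) (f : dgmor A B) n (a : A n) :
  cyc A n a -> cyc B n (f n a).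
Proof. by rewrite /= -mor_diff => ->; rewrite linear0. Qed.

Definition hmap (A B : dgalg) (f : dgmor A B) n (q : homology A n) :
    homology B n :=
  hcls (to_sub (mor_cyc f (sub_ofP (mrepr q)))).

Lemma hmap_cls (A B : dgalg) (f : dgmor A B) n (z : sub_of (cyc A n)) :
  hmap f (hcls z) = hcls (to_sub (mor_cyc f (sub_ofP z))).
Proof.
apply/mcls_eq; have [b hb] : bnd A n (mrepr (hcls z) - z).
  by apply/mcls_eq; exact: mcls_repr.
by exists (f _ b); rewrite -mor_diff hb !raddfB.
Qed.

Definition quasi_iso (A B : dgalg) (f : dgmor A B) : Prop :=
  forall n, bijective (@hmap A B f n).

Inductive quasi_isomorphic : dgalg -> dgalg -> Prop :=
| qi_refl A : quasi_isomorphic A A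
| qi_fwd A B C (f : dgmor A B) :
    quasi_iso f -> quasi_isomorphic B C -> quasi_isomorphic A C
| qi_bwd A B C (f : dgmor B A) :
    quasi_iso f -> quasi_isomorphic B C -> quasi_isomorphic A C.

Definition formal (A : dgalg) : Prop := quasi_isomorphic A (halg A).

End Algebras.

Section Massey.
Context (k : fieldType) (E : smodule k).

Definition reduced_smodule : Prop := forall d (x : E 0%N d), x = 0.

(** The data of a summand [(mu1 o_l mu2) . s]. *)
Record summand r (g : int) := Summand {
  r1 : nat; r2 : nat; e1 : int; e2 : int;
  mu1 : E r1 e1;
  mu2 : E r2 e2;
  s_arity : (r1 + r2 = r.+1)%N;
  s_degree : e1 + e2 = g;
  s_pos : 'I_r1;
  s_perm : 'S_r }.

Definition sterm r g (s : summand r g) : free_operad E r g :=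
  sact (ocomp (s_arity s) (s_degree s) (s_pos s) (fgen (mu1 s)) (fgen (mu2 s)))
       (s_perm s).

Section Arguments.
Context (r : nat) (g : int) (s : summand r g).

Definition perm_args (T : Type) (y : 'I_r -> T) (i : 'I_r) : T :=
  y (((s_perm s)^-1)%g i).

Definition inner_args (T : Type) (y : 'I_r -> T) (q : 'I_(r2 s)) : T :=
  perm_args y (inner_pos (s_arity s) (s_pos s) q).

Definition outer_args (T : Type) (y : 'I_r -> T) (w : T) : 'I_(r1 s) -> T :=
  graft (s_arity s) (s_pos s) (perm_args y) w.

Lemma sum_outer_args (T : Type) (F : T -> int) (y : 'I_r -> T) (w : T) :
  F w = e2 s + \sum_q F (inner_args y q) + 1 ->
  e1 s + \sum_j F (outer_args y w j) = g + \sum_i F (y i) + 1.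
Proof.
move=> hw; rewrite /outer_args sum_graft hw.
have -> : \sum_i F (y i) = \sum_i F (perm_args y i).
  by rewrite (reindex_inj (@perm_inj _ (s_perm s)^-1)).
rewrite (sum_positions (s_arity s) (s_pos s)).
have key (a b c t u : int) : a + b = c -> a + (b + t + 1 + u) = c + (t + u) + 1.
  by move=> <-; rewrite -!addrA [1 + u]addrC.
exact: key (s_degree s).
Qed.

End Arguments.

Section MasseyProduct.
Context (R : subsmodule (free_operad E)) (A : dgalg (presented R)).
Context (r N : nat) (g : int) (G : 'I_N -> summand r g).
Context (x : 'I_r -> hel (halg A)).

Definition inner_deg j : int :=
  e2 (G j) + \sum_q tag (inner_args (s := G j) x q).

Definition massey_deg : int := g + \sum_i tag (x i) + 1.

Definition massey_defined : Prop :=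
  forall j, alg_act (halg A) (pgen R (mu2 (G j))) (x := inner_args x)
              (erefl (inner_deg j)) = 0.

Definition indet_term j (h : halg A (inner_deg j + 1)) : halg A massey_deg :=
  alg_act (halg A) (pgen R (mu1 (G j)))
    (@sum_outer_args r g (G j) _ (fun a => tag a) x (hom h) erefl).

(** The sum, over the summands of the relation, of the subspaces
    [mu1(x, ..., x, H_*(A), x, ..., x)]. *)
Definition indet (c : halg A massey_deg) : Prop :=
  exists h : forall j, halg A (inner_deg j + 1), c = \sum_j indet_term (h j).

Lemma indet_termL j a (u v : halg A (inner_deg j + 1)) :
  indet_term (a *: u + v) = a *: indet_term u + indet_term v.
Proof.
apply: (@alg_linr _ _ (halg A) _ _ (pgen R (mu1 (G j))) (s_pos (G j)) _ a u v).
- by rewrite /outer_args /graft unlift_none.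
- by rewrite /outer_args /graft unlift_none.
- by rewrite /outer_args /graft unlift_none.
move=> i; rewrite /outer_args /graft eq_sym => /unlift_some [i' _ ->].
by split.
Qed.

Lemma indet0 : indet 0.
Proof.
exists (fun=> 0); rewrite big1 // => j _.
have := indet_termL (j := j) 1 0 0; rewrite !scale1r addr0.
by set t := indet_term _ => e; apply: (addrI t); rewrite addr0 -e.
Qed.
Lemma indetL a u v : indet u -> indet v -> indet (a *: u + v).
Proof.
move=> [h ->] [h' ->]; exists (fun j => a *: h j + h' j).
rewrite scaler_sumr -big_split; apply: eq_bigr => j _.
by rewrite indet_termL.
Qed.
Definition indeterminacy : submodule (halg A massey_deg) := Submodule indet0 indetL.

Definition massey_target : lmodType k := mquot indeterminacy.

Record massey_choice := MasseyChoice {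
  mc_y : forall i, sub_of (cyc A (tag (x i)));
  mc_cls : forall i, hcls (mc_y i) = tagged (x i);
  mc_hy := fun i => hom (\val (mc_y i));
  mc_rho : forall j, A (inner_deg j + 1);
  mc_diff : forall j, diff A erefl (mc_rho j)
    = alg_act A (pgen R (mu2 (G j))) (x := inner_args mc_hy)
        (erefl (inner_deg j)) }.

Definition massey_sign j : int :=
  \sum_(p < r) \sum_(q < r | (p < q)%N && (s_perm (G j) q < s_perm (G j) p)%N)
     tag (x p) * tag (x q)
  + e1 (G j)
  + (e2 (G j) - 1)
    * \sum_(p < r | (p < s_pos (G j))%N) tag (perm_args (G j) x p).

Definition massey_cycle (c : massey_choice) : A massey_deg :=
  \sum_j sgn k (massey_sign j)
    *: alg_act A (pgen R (mu1 (G j)))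
         (@sum_outer_args r g (G j) _ (fun a => tag a) (mc_hy c)
            (hom (mc_rho c j)) erefl).

Definition is_massey_product (m : massey_target) : Prop :=
  exists (c : massey_choice) (z : sub_of (cyc A massey_deg)),
    \val z = massey_cycle c /\ m = mcls indeterminacy (hcls z).

End MasseyProduct.
End Massey.

(* Main.v *)
(** Massey products of an algebra with zero differential lie in their
    indeterminacy, since there every [rho] is a cycle.  It remains to see that
    "all Massey products lie in their indeterminacy" is invariant under a
    quasi-isomorphism [f : A -> B].  Choices for [A] push forward to [B], which
    gives the passage from [B] to [A] by injectivity of [f] on homology.  A
    choice for [B] need not come from [A], but it computes the same class,
    modulo indeterminacy, as the push-forward of a choice for [A]: two [rho]'s
    over the same [y] differ by cycles, and changing one [y_i] by [d b] is
    compensated by the relation evaluated at [y] with [b] in place of [y_i]. *)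

From HB Require Import structures.
From mathcomp Require Import all_boot all_order all_fingroup all_algebra.
From mathcomp Require Import boolp.
From mathcomp Require Import ring zify.
Require Import Defs.

Set Implicit Arguments.
Unset Strict Implicit.
Unset Printing Implicit Defensive.
Import GRing.Theory.
Local Open Scope ring_scope.

(** * Signs as powers of -1 with integer exponents *)

Section Signs.
Context (k : fieldType).

Lemma sgnD a b : sgn k (a + b) = sgn k a * sgn k b.
Proof. by rewrite /sgn expfzDr // oppr_eq0 oner_eq0. Qed.

Lemma sgn_sqr a : sgn k a * sgn k a = 1.
Proof. by rewrite /sgn -expfzMl mulrNN mulr1 exp1rz. Qed.

(** A sign depends only on the parity of its exponent. The witness [c] turns a comparison of signs
    into an identity between integers, within reach of [ring]. *)
Lemma sgn_eq a b c : a = b + c + c -> sgn k a = sgn k b.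
Proof. by move=> ->; rewrite !sgnD -mulrA sgn_sqr mulr1. Qed.

Lemma sgn1 : sgn k 1 = -1.
Proof. by rewrite /sgn expr1z. Qed.

End Signs.

(** * Koszul signs of permutations *)

Section Inversions.
Context (r : nat) (s : 'S_r).

(** The exponent of the Koszul sign, as a function of the degrees so that one of them can be
    varied. *)
Definition inv_deg (d : 'I_r -> int) : int :=
  \sum_(p < r) \sum_(q < r | (p < q)%N && (s q < s p)%N) d p * d q.

(** Only the elements that cross the [i]-th one contribute to the change. The two sums count these
    once, and count twice those that precede it both before and after permuting; [c] removes the
    latter. *)
Lemma inv_deg_succ (d d' : 'I_r -> int) i :
  d' i = d i + 1 -> (forall j, j != i -> d' j = d j) ->
  exists c, inv_deg d' = inv_deg d + \sum_(q < r | (q < i)%N) d q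
     + \sum_(p < r | (p < s i)%N) d ((s^-1)%g p) + c + c.
Proof.
move=> di dj.
pose e (j : 'I_r) : int := (j == i)%:R.
have d'E j : d' j = d j + e j.
  by rewrite /e; case: eqVneq => [->|/dj]; rewrite ?di ?addr0.
have e1 (F : 'I_r -> int) : \sum_p e p * F p = F i.
  rewrite (bigD1 i) //= big1 => [|j /negbTE ji]; rewrite /e ?ji ?mul0r //.
  by rewrite eqxx mul1r addr0.
pose c (q : 'I_r) : int := ((q < i)%N && (s q < s i)%N)%:R.
exists (- \sum_q c q * d q).
have -> : \sum_(p < r | (p < s i)%N) d ((s^-1)%g p)
    = \sum_(q < r) (s q < s i)%N%:R * d q.
  rewrite (reindex_inj (@perm_inj _ s)) /= big_mkcond; apply: eq_bigr => q _.
  by rewrite permK; case: ifP; rewrite ?mul1r ?mul0r.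
have -> : \sum_(q < r | (q < i)%N) d q = \sum_(q < r) (q < i)%N%:R * d q.
  by rewrite big_mkcond; apply: eq_bigr => q _; case: ifP; rewrite ?mul1r ?mul0r.
pose t (p q : 'I_r) : int := ((p < q)%N && (s q < s p)%N)%:R.
have invE f : inv_deg f = \sum_p \sum_q t p q * (f p * f q).
  apply: eq_bigr => p _; rewrite big_mkcond; apply: eq_bigr => q _.
  by rewrite /t; case: ifP; rewrite ?mul1r ?mul0r.
have -> : inv_deg d' = inv_deg d + \sum_q t i q * d q + \sum_q t q i * d q.
  rewrite !invE -(e1 (fun p => \sum_q t p q * d q)).
  have -> : \sum_q t q i * d q = \sum_q \sum_p e p * (t q p * d q).
    by apply: eq_bigr => q _; rewrite e1.
  rewrite -!big_split; apply: eq_bigr => p _.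
  rewrite mulr_sumr -!big_split; apply: eq_bigr => q _ /=.
  (* The part quadratic in the increment lives on the diagonal, where there is no inversion. *)
  rewrite !d'E; have : t p q * (e p * e q) = 0.
    rewrite /t /e; case: (eqVneq p i) => [->|_]; last by rewrite mul0r mulr0.
    case: (eqVneq q i) => [->|_]; last by rewrite !mulr0.
    by rewrite ltnn mul0r.
  by move=> h; apply: subr0_eq; rewrite -[RHS]h; ring.
rewrite -!addrA; congr (_ + _); rewrite -!sumrN -!big_split /=.
apply: eq_bigr => q _; rewrite /t /c.
case: (eqVneq q i) => [->|qi]; first by rewrite !ltnn /=; ring.
have si : s q != s i by rewrite (inj_eq perm_inj).
case: (ltngtP q i) => [_|_|/val_inj /eqP]; last by rewrite (negbTE qi).
all: case: (ltngtP (s q) (s i)) => [_|_|/val_inj /eqP]; last by rewrite (negbTE si).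
all: rewrite /=; ring.
Qed.

End Inversions.

(** * Multilinearity and special cases of the Leibniz rule *)

Section Actions.
Context (k : fieldType) (O : operad k) (A : dgalg O).
Implicit Types a : hel A.

Lemma act_suml r e N (mu : 'I_N -> O r e) (x : 'I_r -> hel A) n
    (h : e + \sum_i tag (x i) = n) :
  alg_act A (\sum_j mu j) h = \sum_j alg_act A (mu j) h.
Proof.
have h0 : alg_act A (0 : O r e) h = 0.
  have := alg_linl (1 : k) (0 : O r e) 0 h; rewrite !scale1r addr0 => h0.
  by apply: (addrI (alg_act A (0 : O r e) h)); rewrite addr0 -h0.
apply: (big_morph (fun nu => alg_act A nu h)) => // nu nu'.
by rewrite -[nu]scale1r alg_linl !scale1r.
Qed.

(** The equation for [w] is a separate premise, so that differences such as [v' - v] can be used as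
    entries. *)
Lemma act_lin r e (mu : O r e) i p c (u v w : A p) (x y z : 'I_r -> hel A) n
    (hx : e + \sum_i tag (x i) = n) (hy : e + \sum_i tag (y i) = n)
    (hz : e + \sum_i tag (z i) = n) :
  x i = hom w -> y i = hom u -> z i = hom v -> w = c *: u + v ->
  (forall j : 'I_r, j != i -> y j = x j /\ z j = x j) ->
  alg_act A mu hx = c *: alg_act A mu hy + alg_act A mu hz.
Proof. move=> xi yi zi wE; rewrite wE in xi; exact: alg_linr xi yi zi. Qed.

Definition dhel a : hel A := hom (diff A (subrK 1 (tag a)) (tagged a)).

Lemma dhel_hom n m (h : m + 1 = n) (c : A n) : dhel (hom c) = hom (diff A h c).
Proof.
rewrite /dhel /=; have e : m = n - 1 by rewrite -h addrK.
by subst m; rewrite (eq_irrelevance h (subrK 1 n)).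
Qed.

Lemma leibniz_vanish r e (mu : O r e) (x y : 'I_r -> hel A) n i
    (h : e + \sum_j tag (y j) = n) :
  is_cyc (x i) -> y i = dhel (x i) -> alg_act A mu h = 0.
Proof.
move=> cx yi; apply: (@act_zero _ _ A r e mu y n h i (tag (x i) - 1)).
by rewrite yi /dhel cx.
Qed.

(** Every other term of the Leibniz rule contains the differential of a cycle. *)
Lemma leibniz1 r e (mu : O r e) (x y : 'I_r -> hel A) n m i (hm : m + 1 = n)
    (h : e + \sum_j tag (x j) = n) (h' : e + \sum_j tag (y j) = m) :
  (forall j, j != i -> is_cyc (x j)) ->
  y i = dhel (x i) -> (forall j, j != i -> y j = x j) ->
  diff A hm (alg_act A mu h)
  = sgn k (e + \sum_(j < r | (j < i)%N) tag (x j)) *: alg_act A mu h'.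
Proof.
move=> cx yi yx; rewrite (alg_leibniz mu hm h (leibniz_deg hm h)).
rewrite (bigD1 i) //= [X in _ + X]big1 ?addr0 => [|j ji].
  congr (_ *: _); apply: act_irr; apply/funext => j.
  by case: eqVneq => [->|/yx].
by rewrite (@leibniz_vanish _ _ _ x _ _ j) ?scaler0 ?eqxx //; exact: cx.
Qed.

(** For operations applied both to some [rho] and to a chain [b] between two representatives. *)
Lemma leibniz2 r e (mu : O r e) (x y z : 'I_r -> hel A) n m i i' (hm : m + 1 = n)
    (h : e + \sum_j tag (x j) = n) (h' : e + \sum_j tag (y j) = m)
    (h'' : e + \sum_j tag (z j) = m) :
  i' != i -> (forall j, j != i -> j != i' -> is_cyc (x j)) ->
  y i = dhel (x i) -> (forall j, j != i -> y j = x j) ->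
  z i' = dhel (x i') -> (forall j, j != i' -> z j = x j) ->
  diff A hm (alg_act A mu h)
  = sgn k (e + \sum_(j < r | (j < i)%N) tag (x j)) *: alg_act A mu h'
    + sgn k (e + \sum_(j < r | (j < i')%N) tag (x j)) *: alg_act A mu h''.
Proof.
move=> ii' cx yi yx zi zx; rewrite (alg_leibniz mu hm h (leibniz_deg hm h)).
rewrite (bigD1 i) //= [X in _ + X](bigD1 i') //=.
rewrite [X in _ + (_ + X)]big1 ?addr0 => [|j /andP[ji ji']].
  congr (_ *: _ + _ *: _); apply: act_irr; apply/funext => j.
    by case: eqVneq => [->|/yx].
  by case: eqVneq => [->|/zx].
by rewrite (@leibniz_vanish _ _ _ x _ _ j) ?scaler0 ?eqxx //; exact: cx.
Qed.

End Actions.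

(** * Homology classes and the maps induced on homology *)

Section Homology.
Context (k : fieldType) (O : operad k).
Implicit Types A B : dgalg O.

Lemma hcls_eq A n (u v : sub_of (cyc A n)) :
  hcls u = hcls v <-> exists b : A (n + 1), diff A erefl b = \val u - \val v.
Proof. by rewrite /hcls mcls_eq /= /is_bnd raddfB. Qed.

Lemma hcls_scale A n c (u : sub_of (cyc A n)) : hcls (c *: u) = c *: hcls u.
Proof. exact: linearZ. Qed.

Lemma hcls_repr A n (q : homology A n) : hcls (mrepr q) = q.
Proof. exact: mcls_repr. Qed.

Lemma hrep_heq_cls A (q : hel (halg A)) (z : sub_of (cyc A (tag q))) :
  hcls z = tagged q -> heq (hrep q) (hom (\val z)).
Proof.
by case: q z => n q z /= <-; exact: hrep_heq.
Qed.

Section Maps.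
Context (A B : dgalg O) (f : dgmor A B).

Lemma hmap_lin n : linear (@hmap k O A B f n).
Proof.
move=> c p q; rewrite -(hcls_repr p) -(hcls_repr q) /hcls -mcls_linear.
rewrite !hmap_cls /hcls -mcls_linear; congr mcls; apply: val_inj.
by rewrite /= !linearP.
Qed.
HB.instance Definition _ n :=
  GRing.isLinear.Build k (homology A n) (homology B n) *:%R (@hmap k O A B f n)
    (@hmap_lin n).

Definition mor_hel (a : hel A) : hel B := hom (f (tag a) (tagged a)).
Definition hmap_hel (q : hel (halg A)) : hel (halg B) := hom (hmap f (tagged q)).

(** The representatives that [hact] selects in [B] need not be images of those selected in [A];
    [hactE] allows the images to be used instead. *)
Lemma hmap_act r e (mu : O r e) (x : 'I_r -> hel (halg A)) n
    (h : e + \sum_i tag (x i) = n) :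
  hmap f (alg_act (halg A) mu h)
  = alg_act (halg B) mu (x := fun i => hmap_hel (x i)) h.
Proof.
rewrite /= /hact hmap_cls; set z := to_sub _.
have cz : cyc B n (alg_act B mu (x := fun i => mor_hel (hrep (x i))) h).
  by rewrite -mor_act; exact: sub_ofP z.
rewrite [RHS](@hactE _ _ B r e mu (fun i => hmap_hel (x i))
  (fun i => mor_hel (hrep (x i))) n h h cz).
  by congr hcls; apply: val_inj; rewrite /= mor_act.
move=> i; exact: (@hrep_heq_cls B (hmap_hel (x i))
  (to_sub (mor_cyc f (sub_ofP (mrepr (tagged (x i)))))) erefl).
Qed.

End Maps.
End Homology.

(** * Sums of degrees over the inputs of a partial composite *)

Section PositionSums.
Context (m n r : nat) (hr : (m + n = r.+1)%N) (i : 'I_m).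

(** Otherwise [sum_positions] would give total 0 to the indicator function of [p], whose sum is
    1. *)
Lemma positionP p :
  (exists q : 'I_n, p = inner_pos hr i q) \/ (exists j, p = outer_pos (n := n) hr i j).
Proof.
case: (pselect (exists q : 'I_n, p = inner_pos hr i q)) => [|ni]; first by left.
case: (pselect (exists j, p = outer_pos (n := n) hr i j)) => [|no]; first by right.
have h0 : \sum_(q < r) (q == p)%:R = 1 :> int.
  by rewrite (bigD1 p) //= eqxx big1 ?addr0 // => q /negbTE ->.
have := sum_positions hr i (fun q => (q == p)%:R : int).
rewrite h0 [X in _ = X + _]big1 ?[X in _ = _ + X]big1 // => q _.
  by case: eqP => // e; case: no; exists q.
by case: eqP => // e; case: ni; exists q.
Qed.

Lemma sum_graftP (T : Type) (F : T -> int) (x : 'I_r -> T) w (P : pred 'I_m) :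
  \sum_(p | P p) F (graft hr i x w p)
  = (if P i then F w else 0)
    + \sum_j (if P (lift i j) then F (x (outer_pos hr i j)) else 0).
Proof.
rewrite big_mkcond (bigD1_ord i) //= /graft unlift_none; congr (_ + _).
by apply: eq_bigr => j _; rewrite liftK.
Qed.

Lemma sum_positionsP (d : 'I_r -> int) (P : pred 'I_r) :
  \sum_(p | P p) d p
  = \sum_q (if P (inner_pos hr i q) then d (inner_pos hr i q) else 0)
    + \sum_j (if P (outer_pos hr i j) then d (outer_pos hr i j) else 0).
Proof. by rewrite big_mkcond (sum_positions hr i). Qed.

Lemma outer_pos_lt j : (outer_pos hr i j < i)%N = (j < i)%N.
Proof.
rewrite /=; case: (ltnP j i) => // ij; apply/negbTE; rewrite -leqNgt.
exact: leq_trans ij (leq_addr _ _).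
Qed.

Lemma lift_lt (j : 'I_m.-1) : (lift i j < i)%N = (j < i)%N.
Proof. by rewrite /= /bump; case: leqP => ij /=; lia. Qed.

Lemma lift_gt (j : 'I_m.-1) : (i < lift i j)%N = ~~ (j < i)%N.
Proof. by rewrite /= /bump; case: leqP => ij /=; lia. Qed.

Lemma sum_before_inner (d : 'I_r -> int) q0 :
  \sum_(p < r | (p < inner_pos hr i q0)%N) d p
  = \sum_(p < r | (p < i)%N) d p + \sum_(q < n | (q < q0)%N) d (inner_pos hr i q).
Proof.
rewrite [X in _ = _ + X]big_mkcond !sum_positionsP /=.
rewrite [X in _ = X + _ + _]big1 ?add0r => [|q _]; last by rewrite ltnNge leq_addr.
rewrite addrC; congr (_ + _); apply: eq_bigr => j _.
  by congr (if _ then _ else _); case: (ltnP j i) => ji; have := ltn_ord q0; lia.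
by rewrite ltn_add2l.
Qed.

Lemma sum_before_pos (T : Type) (F : T -> int) (x : 'I_r -> T) w :
  \sum_(p < m | (p < i)%N) F (graft hr i x w p) = \sum_(p < r | (p < i)%N) F (x p).
Proof.
rewrite sum_graftP ltnn add0r sum_positionsP [X in _ = X + _]big1 ?add0r => [|q _].
  by apply: eq_bigr => j _; rewrite lift_lt outer_pos_lt.
by rewrite /= ltnNge leq_addr.
Qed.

(** Before a later outer input, the composite has all the inner inputs where the outer operation has
    the single entry [w]; before an earlier one, neither occurs. *)
Lemma sum_before_outer (T : Type) (F : T -> int) (x : 'I_r -> T) w j0 :
  \sum_(p < m | (p < lift i j0)%N) F (graft hr i x w p)
  = \sum_(p < r | (p < outer_pos hr i j0)%N) F (x p)
    + (if (j0 < i)%N then 0 else F w - \sum_q F (x (inner_pos hr i q))).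
Proof.
rewrite sum_graftP lift_gt sum_positionsP.
have -> : \sum_q (if (inner_pos hr i q < outer_pos hr i j0)%N
                  then F (x (inner_pos hr i q)) else 0)
   = if (j0 < i)%N then 0 else \sum_q F (x (inner_pos hr i q)).
  case: ltnP => ji.
    by rewrite big1 // => q _; rewrite /= ji ltnNge (leq_trans (ltnW ji) (leq_addr _ _)).
  by apply: eq_bigr => q _; rewrite /= [(j0 < i)%N]ltnNge ji /= -addnS leq_add.
have -> : \sum_j (if (lift i j < lift i j0)%N then F (x (outer_pos hr i j)) else 0)
    = \sum_j (if (outer_pos hr i j < outer_pos hr i j0)%N
              then F (x (outer_pos hr i j)) else 0).
  apply: eq_bigr => j _; congr (if _ then _ else _).
  by rewrite /= /bump; case: (ltnP j i) => ji; case: (ltnP j0 i) => j0i /=; lia.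
by case: (j0 < i)%N => /=; ring.
Qed.

End PositionSums.

(** * Summands of a relation acting on an algebra *)

Section Summands.
Context (k : fieldType) (E : smodule k) (R : subsmodule (free_operad E)).
Context (A : dgalg (presented R)).

Lemma pcls_sum r g N (t : 'I_N -> free_operad E r g) :
  pcls R (\sum_j t j) = \sum_j pcls R (t j).
Proof. exact: raddf_sum. Qed.

(** The relation is zero in [presented R], whatever the arguments [u], cycles or not. *)
Lemma relation_act r g N (G : 'I_N -> summand E r g) (u : 'I_r -> hel A) n
    (h : g + \sum_i tag (u i) = n) :
  R r g (\sum_j sterm (G j)) -> \sum_j alg_act A (pcls R (sterm (G j))) h = 0.
Proof.
move=> GR; rewrite -act_suml -pcls_sum.
have -> : pcls R (\sum_j sterm (G j)) = 0.
  have <- : mcls (rel_ideal R r g) 0 = 0 by exact: linear0.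
  by apply/mcls_eq; rewrite subr0; exact: gi_rel.
(* The zero operation acts as zero, being an empty sum. *)
by have := act_suml (fun _ : 'I_0 => 0 : presented R r g) h; rewrite !big_ord0.
Qed.

Section Summand.
Context (r : nat) (g : int) (s : summand E r g).

(** One sign comes from the permutation, the other from moving [mu2 s] past the arguments before its
    slot. *)
Lemma act_sterm (u : 'I_r -> hel A) n l (h : g + \sum_i tag (u i) = n)
    (hl : e2 s + \sum_q tag (inner_args (s := s) u q) = l)
    (h' : e1 s + \sum_j tag (outer_args (s := s) u
            (hom (alg_act A (pgen R (mu2 s)) hl)) j) = n) :
  alg_act A (pcls R (sterm s)) h
  = sgn k (inv_deg (s_perm s) (fun i => tag (u i))
           + e2 s * \sum_(p < r | (p < s_pos s)%N) tag (perm_args s u p))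
    *: alg_act A (pgen R (mu1 s)) h'.
Proof.
have -> : pcls R (sterm s) = sact (ocomp (s_arity s) (s_degree s) (s_pos s)
    (pgen R (mu1 s)) (pgen R (mu2 s))) (s_perm s).
  by rewrite /= /pgen /pcls qcomp_pi qact_pi.
have hp : g + \sum_i tag (u ((s_perm s)^-1%g i)) = n.
  by rewrite -h; congr (_ + _); rewrite [RHS](reindex_inj (@perm_inj _ (s_perm s)^-1%g)).
rewrite (alg_perm _ h hp) sgnD -scalerA; congr (_ *: _).
exact: (@alg_comp _ _ A _ _ _ _ _ _ _ _ _ _ _ (perm_args s u) _ _ hp hl h').
Qed.

(** The exponent $\gamma$ of the Massey product. The degrees are a variable because it is also
    needed at those of [homotopy_args], where one is raised by one. *)
Definition term_sign (d : 'I_r -> int) : int :=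
  inv_deg (s_perm s) d + e1 s
  + (e2 s - 1) * \sum_(p < r | (p < s_pos s)%N) d ((s_perm s)^-1%g p).

(** All arguments except [rho] are cycles, so one Leibniz term survives. Its sign combined with
    $\gamma$ has the parity of the sign in [act_sterm], which is what $\gamma$ is designed for. *)
Lemma diff_massey_term (y : 'I_r -> hel A) l n (rho : A (l + 1))
    (hl : e2 s + \sum_q tag (inner_args (s := s) y q) = l)
    (h : e1 s + \sum_j tag (outer_args (s := s) y (hom rho) j) = n + 1)
    (hy : g + \sum_i tag (y i) = n) :
  (forall i, is_cyc (y i)) ->
  diff A erefl rho = alg_act A (pgen R (mu2 s)) hl ->
  sgn k (term_sign (fun i => tag (y i)))
    *: diff A erefl (alg_act A (pgen R (mu1 s)) h)
  = alg_act A (pcls R (sterm s)) hy.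
Proof.
move=> cy drho.
have h' : e1 s + \sum_j tag (outer_args (s := s) y
            (hom (alg_act A (pgen R (mu2 s)) hl)) j) = n.
  apply: (addIr 1); rewrite -h /outer_args !sum_graft /=; ring.
rewrite (act_sterm hy h').
rewrite (@leibniz1 _ _ A _ _ _ _ (outer_args (s := s) y
            (hom (alg_act A (pgen R (mu2 s)) hl))) _ _ (s_pos s) erefl h h').
- rewrite scalerA -sgnD; congr (_ *: _).
  rewrite /outer_args sum_before_pos /term_sign /perm_args.
  set S := \sum_(p < r | _) _; apply: (@sgn_eq _ _ _ (e1 s)); ring.
- move=> j; rewrite /outer_args /graft eq_sym => /unlift_some [j' _ ->].
  exact: cy.
- by rewrite /outer_args /graft unlift_none (dhel_hom erefl) drho.
move=> j; rewrite /outer_args /graft eq_sym => /unlift_some [j' _ ->] //.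
Qed.

(** * Replacing one representative by a homologous cycle *)

Section ChangeOfCycle.
Context (y y' : 'I_r -> hel A) (i : 'I_r) (p : int) (v v' : A p) (b : A (p + 1)).
Hypothesis cy : forall j, is_cyc (y j).
Hypothesis yi : y i = hom v.
Hypothesis y'i : y' i = hom v'.
Hypothesis y'j : forall j, j != i -> y' j = y j.
Hypothesis db : diff A erefl b = v' - v.

Definition homotopy_args j : hel A := if j == i then hom b else y j.
Local Notation u := homotopy_args.

(** Up to the final 1, the Leibniz sign for differentiating the [i]-th argument of an operation of
    degree [g]. *)
Definition change_sign : int := \sum_(q < r | (q < i)%N) tag (y q) + g + 1.

(** The slot of the [i]-th argument in the composite once the arguments are permuted. *)
Let t := s_perm s i.

Let perm_u q : perm_args s u q = if q == t then hom b else perm_args s y q.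
Proof. by rewrite /perm_args /u (can2_eq (permKV _) (permK _)). Qed.

Let perm_y : perm_args s y t = hom v.
Proof. by rewrite /perm_args permK. Qed.

Let perm_y' : perm_args s y' t = hom v'.
Proof. by rewrite /perm_args permK. Qed.

Let perm_y'j q : q != t -> perm_args s y' q = perm_args s y q.
Proof. by move=> qt; apply: y'j; rewrite (can2_eq (permKV _) (permK _)). Qed.

Let inv_u : exists c, inv_deg (s_perm s) (fun j => tag (u j))
  = inv_deg (s_perm s) (fun j => tag (y j)) + \sum_(q < r | (q < i)%N) tag (y q)
    + \sum_(q < r | (q < t)%N) tag (perm_args s y q) + c + c.
Proof.
apply: inv_deg_succ => [|j ji]; first by rewrite /u eqxx yi.
by rewrite /u (negbTE ji).
Qed.

(** Summed over the relation, the terms [alg_act A (pcls R (sterm s)) hu] cancel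
    and [change_sign] does not depend on [s], so replacing the cycle [v] by the
    homologous [v'] changes the Massey cycle by the boundary of [sum m]. *)
Lemma change_cycle l n (rho : A (l + 1))
    (hl : e2 s + \sum_q tag (inner_args (s := s) y q) = l)
    (hl' : e2 s + \sum_q tag (inner_args (s := s) y' q) = l)
    (h : e1 s + \sum_j tag (outer_args (s := s) y (hom rho) j) = n)
    (hu : g + \sum_i tag (u i) = n) :
  diff A erefl rho = alg_act A (pgen R (mu2 s)) hl ->
  exists (rho' : A (l + 1)) (m : A (n + 1)),
    diff A erefl rho' = alg_act A (pgen R (mu2 s)) hl'
    /\ forall h' : e1 s + \sum_j tag (outer_args (s := s) y' (hom rho') j) = n,
    diff A erefl m = alg_act A (pcls R (sterm s)) hu
      + sgn k change_sign *: (sgn k (term_sign (fun j => tag (y j)))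
         *: (alg_act A (pgen R (mu1 s)) h' - alg_act A (pgen R (mu1 s)) h)).
Proof.
move=> drho; have [c inv_c] := inv_u.
(* The changed argument enters either [mu2 s], in which case [rho] is corrected and [m] is zero, or
   [mu1 s] directly, in which case [rho] is kept and [m] is built from [b]. *)
have [[q0 tq]|[j0 tj]] := positionP (s_arity s) (s_pos s) t.
- have tt' j : outer_pos (s_arity s) (s_pos s) j != t.
    by rewrite tq eq_sym inner_outer_neq.
  have outer_u w : outer_args (s := s) u w = outer_args (s := s) y w.
    apply/funext => j; rewrite /outer_args /graft; case: unlift => // j'.
    by rewrite perm_u (negbTE (tt' j')).
  have outer_y' w : outer_args (s := s) y' w = outer_args (s := s) y w.
    apply/funext => j; rewrite /outer_args /graft; case: unlift => // j'.
    by rewrite perm_y'j.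
  have inner_u q : inner_args (s := s) u q
      = if q == q0 then hom b else inner_args (s := s) y q.
    by rewrite /inner_args perm_u tq (inj_eq (@inner_pos_inj _ _ _ _ _)).
  have hlu : e2 s + \sum_q tag (inner_args (s := s) u q) = l + 1.
    rewrite -hl (bigD1 q0) //= [in RHS](bigD1 q0) //= inner_u eqxx.
    rewrite [X in _ + (_ + X)](eq_bigr (fun q => tag (inner_args (s := s) y q))).
      by rewrite /inner_args -tq perm_y /=; ring.
    by move=> q /negbTE qq; rewrite inner_u qq.
  (* This is the Leibniz sign of [b], so the boundary of [eps *: nu] is exactly the change of the
     inner product. *)
  pose eps := sgn k (e2 s + \sum_(q < r2 s | (q < q0)%N) tag (inner_args (s := s) y q)).
  pose nu := alg_act A (pgen R (mu2 s)) hlu.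
  have drho' : diff A erefl (rho + eps *: nu) = alg_act A (pgen R (mu2 s)) hl'.
    have hd : e2 s + \sum_q tag (if q == q0 then hom (v' - v)
                 else inner_args (s := s) y q) = l.
      rewrite -hl (bigD1 q0) //= [in RHS](bigD1 q0) //= eqxx.
      rewrite [X in _ + (_ + X)](eq_bigr (fun q => tag (inner_args (s := s) y q))).
        by rewrite /inner_args -tq perm_y.
      by move=> q /negbTE ->.
    rewrite linearD linearZ /= drho /nu.
    rewrite (@leibniz1 _ _ A _ _ _ _ (fun q => if q == q0 then hom (v' - v)
                 else inner_args (s := s) y q) _ _ q0 erefl hlu hd).
    + have -> : \sum_(q < r2 s | (q < q0)%N) tag (inner_args (s := s) u q)
              = \sum_(q < r2 s | (q < q0)%N) tag (inner_args (s := s) y q).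
        apply: eq_bigr => q qq; rewrite inner_u; case: eqP => // e.
        by rewrite e ltnn in qq.
      rewrite scalerA sgn_sqr scale1r addrC.
      rewrite (@act_lin _ _ A _ _ _ q0 p (-1) v v' (v' - v) _
        (inner_args (s := s) y) (inner_args (s := s) y') _ hd hl hl').
      * by rewrite scaleN1r addrAC addNr add0r.
      * by rewrite eqxx.
      * by rewrite /inner_args -tq.
      * by rewrite /inner_args -tq.
      * by rewrite scaleN1r addrC.
      move=> q /negbTE qq; rewrite qq; split=> //; rewrite /inner_args perm_y'j //.
      by rewrite tq (inj_eq (@inner_pos_inj _ _ _ _ _)) qq.
    + by move=> q /negbTE qq; rewrite inner_u qq; exact: cy.
    + by rewrite inner_u eqxx (dhel_hom erefl) db.
    by move=> q /negbTE qq; rewrite inner_u qq.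
  exists (rho + eps *: nu), 0; split=> // h'.
  have hn : e1 s + \sum_j tag (outer_args (s := s) u (hom nu) j) = n.
    by rewrite outer_u -h /outer_args !sum_graft.
  have hn' : e1 s + \sum_j tag (outer_args (s := s) y (hom nu) j) = n.
    by rewrite -h /outer_args !sum_graft.
  (* Two multiples of [mu1 s] applied to [nu] remain, one from the relation and one from the
     correction of [rho]; they have to cancel. *)
  rewrite (act_sterm hu hn) linear0.
  have -> : alg_act A (pgen R (mu1 s)) hn = alg_act A (pgen R (mu1 s)) hn'.
    exact: act_irr.
  rewrite (@act_lin _ _ A _ _ _ (s_pos s) _ eps nu rho (rho + eps *: nu) _ _ _ _
             h' hn' h).
  + rewrite addrK !scalerA -scalerDl -!sgnD inv_c.
    have -> : \sum_(q < r | (q < s_pos s)%N) tag (perm_args s u q)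
            = \sum_(q < r | (q < s_pos s)%N) tag (perm_args s y q).
      apply: eq_bigr => q qq; rewrite perm_u; case: eqP => // e.
      by rewrite e tq /= ltnNge leq_addr in qq.
    rewrite tq sum_before_inner /change_sign /term_sign /perm_args /inner_args.
    set S := \sum_(q < r | (q < s_pos s)%N) _.
    set Q := \sum_(q < r | (q < i)%N) _.
    set I := inv_deg _ _.
    rewrite /perm_args; set T := \sum_(q < r2 s | _) _.
    set a := I + _ + _ + _ + _ + _.
    (* The exponents differ by an odd number because [e1 s + e2 s = g]. *)
    rewrite [sgn k (_ + g + _ + _ + _)](@sgn_eq _ _ (a + 1) (g - S - c)).
      by rewrite sgnD sgn1 mulrN1 addrN scale0r.
    have := s_degree s; rewrite /a; move: (e1 s) (e2 s) => e e' <-; ring.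
  + by rewrite outer_y' /outer_args /graft unlift_none.
  + by rewrite /outer_args /graft unlift_none.
  + by rewrite /outer_args /graft unlift_none.
  + exact: addrC.
  move=> j; rewrite outer_y' /outer_args /graft eq_sym => /unlift_some [j' _ ->] //.
have ttq q : inner_pos (s_arity s) (s_pos s) q != t by rewrite tj inner_outer_neq.
have inner_u : inner_args (s := s) u = inner_args (s := s) y.
  by apply/funext => q; rewrite /inner_args perm_u (negbTE (ttq q)).
have inner_y' : inner_args (s := s) y' = inner_args (s := s) y.
  by apply/funext => q; rewrite /inner_args perm_y'j.
have hlu : e2 s + \sum_q tag (inner_args (s := s) u q) = l by rewrite inner_u.
have hm : e1 s + \sum_j tag (outer_args (s := s) u (hom rho) j) = n + 1.
  rewrite -h /outer_args !sum_graft.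
  rewrite (bigD1 j0) //= [in RHS](bigD1 j0) //= perm_u -tj eqxx perm_y /=.
  rewrite [X in _ + (_ + (_ + X))](eq_bigr
     (fun j => tag (perm_args s y (outer_pos (s_arity s) (s_pos s) j)))); first by ring.
  move=> j /negbTE jj; rewrite perm_u tj.
  by rewrite (inj_eq (@outer_pos_inj _ _ _ _ _)) jj.
pose i0 := lift (s_pos s) j0.
pose z j := if j == i0 then hom (v' - v) else outer_args (s := s) y (hom rho) j.
have argsE Y w : outer_args (s := s) Y w i0 = perm_args s Y t.
  by rewrite /outer_args /graft liftK tj.
have hz : e1 s + \sum_j tag (z j) = n.
  rewrite -h; congr (_ + _); apply: eq_bigr => j _; rewrite /z.
  by case: eqP => // ->; rewrite argsE perm_y.
have hn : e1 s + \sum_j tag (outer_args (s := s) u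
            (hom (alg_act A (pgen R (mu2 s)) hlu)) j) = n.
  apply: (addIr 1); rewrite -hm /outer_args !sum_graft /=; ring.
(* With the sign taken at the degrees of [u], differentiating [rho] gives the relation term at [u];
   differentiating [b] gives the change of the Massey term. *)
exists rho, (sgn k (term_sign (fun j => tag (u j))) *: alg_act A (pgen R (mu1 s)) hm).
split=> [|h']; first by rewrite drho; apply: act_irr; rewrite inner_y'.
rewrite linearZ /=.
rewrite (@leibniz2 _ _ A _ _ _ _ (outer_args (s := s) u
            (hom (alg_act A (pgen R (mu2 s)) hlu))) z _ _ (s_pos s) i0 erefl hm hn hz).
- rewrite (act_sterm hu hn) scalerDr !scalerA -!sgnD; congr (_ *: _ + _).
    rewrite /outer_args sum_before_pos /term_sign /perm_args.
    set S := \sum_(p < r | _) _; apply: (@sgn_eq _ _ _ (e1 s)); ring.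
  have -> : alg_act A (pgen R (mu1 s)) hz
      = alg_act A (pgen R (mu1 s)) h' - alg_act A (pgen R (mu1 s)) h.
    rewrite (@act_lin _ _ A _ _ _ i0 p (-1) v v' (v' - v) _
       (outer_args (s := s) y (hom rho))
       (outer_args (s := s) y' (hom rho)) _ hz h h').
    + by rewrite scaleN1r addrC.
    + by rewrite /z eqxx.
    + by rewrite argsE.
    + by rewrite argsE.
    + by rewrite scaleN1r addrC.
    move=> j ji; rewrite /z (negbTE ji); split=> //.
    rewrite /outer_args /graft; case: unliftP => // j' jj.
    apply: perm_y'j; rewrite tj (inj_eq (@outer_pos_inj _ _ _ _ _)).
    by apply: contra ji => /eqP e; rewrite jj /i0 e.
  congr (_ *: _).
  (* If [rho] precedes [b], it stands for the inner inputs and exceeds their total degree by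
     [e2 s + 1]. *)
  have -> : \sum_(j < r1 s | (j < i0)%N) tag (outer_args (s := s) u (hom rho) j)
      = \sum_(q < r | (q < t)%N) tag (perm_args s y q)
        + (if (j0 < s_pos s)%N then 0 else e2 s + 1).
    rewrite sum_before_outer -tj; congr (_ + _).
      apply: eq_bigr => q qt; rewrite perm_u; case: eqP => // e.
      by rewrite e ltnn in qt.
    by case: ifP => // _; rewrite [tag _]/= -[X in X + 1 - _]hlu /inner_args; ring.
  (* The extra degree of [b] enters the last sum only if its slot precedes that of [rho]. *)
  have -> : term_sign (fun j => tag (u j))
      = inv_deg (s_perm s) (fun j => tag (u j)) + e1 s
        + (e2 s - 1) * (\sum_(q < r | (q < s_pos s)%N) tag (perm_args s y q)
                         + (j0 < s_pos s)%N%:R).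
    congr (_ + _ * _).
    rewrite -(outer_pos_lt (s_arity s)) -tj big_mkcond [in RHS]big_mkcond /=.
    rewrite (bigD1 t) //= [in RHS](bigD1 t) //= [tag (u _)](_ : _ = p + 1); last first.
      by rewrite -[u _]/(perm_args s u t) perm_u eqxx.
    rewrite perm_y /= addrAC; congr (_ + _).
      by case: ifP; rewrite ?addr0.
    apply: eq_bigr => q /negbTE qt; congr (if _ then _ else _).
    by rewrite -[u _]/(perm_args s u q) perm_u qt.
  rewrite inv_c /term_sign /change_sign.
  set P := \sum_(q < r | (q < t)%N) _.
  rewrite /perm_args; set S := \sum_(q < r | (q < s_pos s)%N) _.
  set I := inv_deg _ _; case: (j0 < s_pos s)%N => /=.
    apply: (@sgn_eq _ _ _ (P + c - 1)).
    by have := s_degree s; move: (e1 s) (e2 s) => e e' <-; ring.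
  apply: (@sgn_eq _ _ _ (P + c)).
  by have := s_degree s; move: (e1 s) (e2 s) => e e' <-; ring.
- by rewrite eq_sym neq_lift.
- move=> j ji ji0; move: ji ji0; rewrite /outer_args /graft; case: unliftP => [j' ->|->].
    move=> _ jj; rewrite perm_u tj (inj_eq (@outer_pos_inj _ _ _ _ _)).
    by case: eqP => [e|_]; [case/eqP: jj; rewrite e | exact: cy].
  by rewrite eqxx.
- rewrite /outer_args /graft unlift_none (dhel_hom erefl) drho; congr hom.
  by apply: act_irr; rewrite inner_u.
- by move=> j; rewrite /outer_args /graft eq_sym => /unlift_some [j' _ ->].
- by rewrite /z eqxx argsE perm_u eqxx (dhel_hom erefl) db.
move=> j ji; rewrite /z (negbTE ji) /outer_args /graft; case: unliftP => // j' jj.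
rewrite perm_u tj (inj_eq (@outer_pos_inj _ _ _ _ _)).
by case: eqP => // e; case/eqP: ji; rewrite jj e.
Qed.

End ChangeOfCycle.
End Summand.
End Summands.

(** * Massey classes and their dependence on the choices *)

Section Massey.
Context (k : fieldType) (E : smodule k) (R : subsmodule (free_operad E)).
Context (r N : nat) (g : int) (G : 'I_N -> summand E r g).
Hypothesis G_rel : R r g (\sum_j sterm (G j)).
Implicit Types A B : dgalg (presented R).

(** By [diff_massey_term] the boundary is the relation evaluated at the chosen cycles. *)
Lemma massey_cycle_cyc A (x : 'I_r -> hel (halg A)) (c : massey_choice G x) :
  cyc A _ (massey_cycle c).
Proof.
apply/(@cycP _ _ A _ (g + \sum_i tag (x i)) erefl).
rewrite linear_sum -[RHS](@relation_act _ _ _ A r g N G (mc_hy c) _ erefl G_rel).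
apply: eq_bigr => j _; rewrite linearZ /=.
apply: (@diff_massey_term _ _ _ A r g (G j) (mc_hy c) (inner_deg G x j) _ (mc_rho c j)
  erefl _ erefl); [move=> i; exact: sub_ofP | exact: mc_diff].
Qed.

Definition massey_class A (x : 'I_r -> hel (halg A)) (c : massey_choice G x) :
  halg A (massey_deg g x) := hcls (to_sub (massey_cycle_cyc c)).

Section Choices.
Context (A : dgalg (presented R)) (x : 'I_r -> hel (halg A)).

Section Representatives.
Context (y : forall i, sub_of (cyc A (tag (x i)))).
Hypothesis yx : forall i, hcls (y i) = tagged (x i).
Let hy i : hel A := hom (\val (y i)).

Lemma rep_cyc i : is_cyc (hy i).
Proof. exact: sub_ofP. Qed.

Lemma rep_heq i : heq (hrep (x i)) (hy i).
Proof. exact: hrep_heq_cls. Qed.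

(** The inner product of any representatives represents the product of their classes, which is zero
    exactly when that cycle bounds. *)
Lemma inner_act_eq0 j :
  alg_act (halg A) (pgen R (mu2 (G j))) (x := inner_args (s := G j) x)
    (erefl (inner_deg G x j)) = 0
  <-> exists rho : A (inner_deg G x j + 1),
      diff A erefl rho = alg_act A (pgen R (mu2 (G j)))
        (x := inner_args (s := G j) hy) (erefl (inner_deg G x j)).
Proof.
have cz : cyc A (inner_deg G x j) (alg_act A (pgen R (mu2 (G j)))
    (x := inner_args (s := G j) hy) (erefl (inner_deg G x j))).
  by apply: act_cyc => q; exact: rep_cyc.
have -> : alg_act (halg A) (pgen R (mu2 (G j))) (x := inner_args (s := G j) x)
    (erefl (inner_deg G x j)) = hcls (to_sub cz).
  by apply: hactE => q; exact: rep_heq.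
have -> : 0 = hcls (0 : sub_of (cyc A (inner_deg G x j))) by rewrite /hcls linear0.
by split=> [/hcls_eq[b hb]|[b hb]]; [|apply/hcls_eq]; exists b; rewrite hb /= subr0.
Qed.

Lemma choice_of_reps : massey_defined G x ->
  exists c : massey_choice G x, forall i, mc_y c i = y i.
Proof.
move=> xd; pose rho j := cid ((inner_act_eq0 j).1 (xd j)).
by exists (@MasseyChoice _ _ _ _ _ _ _ _ x y yx (fun j => sval (rho j))
  (fun j => svalP (rho j))).
Qed.

(** Applied to cycles, [mu1] represents its value on their classes, which is an [indet_term]; the
    signs are absorbed into the classes of the [rho j]. *)
Lemma indet_cycles (rho : forall j, A (inner_deg G x j + 1))
    (z : sub_of (cyc A (massey_deg g x))) :
  (forall j, cyc A _ (rho j)) ->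
  \val z = \sum_j sgn k (massey_sign G x j)
    *: alg_act A (pgen R (mu1 (G j)))
         (@sum_outer_args _ _ r g (G j) _ (fun a => tag a) hy (hom (rho j)) erefl) ->
  indet (x := x) G (hcls z).
Proof.
move=> crho zE.
exists (fun j => sgn k (massey_sign G x j) *: hcls (to_sub (crho j))).
pose hh j := hcls (to_sub (crho j)) : halg A (inner_deg G x j + 1).
have termE j : cyc A (massey_deg g x) (alg_act A (pgen R (mu1 (G j)))
   (@sum_outer_args _ _ r g (G j) _ (fun a => tag a) hy (hom (rho j)) erefl)).
  apply: act_cyc => i; rewrite /outer_args /graft; case: unlift => [i'|].
    exact: rep_cyc.
  exact: crho.
rewrite (eq_bigr (fun j => hcls (sgn k (massey_sign G x j) *: to_sub (termE j)))).
  rewrite /hcls -linear_sum; congr mcls; apply: val_inj.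
  by rewrite raddf_sum zE; apply: eq_bigr.
move=> j _; rewrite hcls_scale.
have -> : indet_term (sgn k (massey_sign G x j) *: hcls (to_sub (crho j)))
   = sgn k (massey_sign G x j) *: indet_term (hh j).
  have := indet_termL (j := j) (sgn k (massey_sign G x j)) (hh j) 0.
  rewrite addr0 => ->; rewrite [X in _ + X](_ : _ = 0) ?addr0 //.
  (* Linearity at zero reads [t = t + t], hence [t = 0]. *)
  have := indet_termL (j := j) 1 (0 : halg A (inner_deg G x j + 1)) 0.
  rewrite !scale1r addr0; set t := indet_term _ => e.
  by apply: (addrI t); rewrite addr0 -e.
congr (_ *: _); apply: hactE => i; rewrite /outer_args /graft.
case: unlift => [i'|]; first exact: rep_heq.
exact: hrep_heq (to_sub (crho j)).
Qed.

End Representatives.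

Lemma massey_choiceP : massey_defined G x <-> inhabited (massey_choice G x).
Proof.
split=> [xd|[c] j].
  have yx i : hcls (mrepr (tagged (x i))) = tagged (x i) by exact: hcls_repr.
  by have [c _] := choice_of_reps yx xd; constructor.
apply: (inner_act_eq0 (mc_cls c) j).2; exists (mc_rho c j); exact: mc_diff.
Qed.

(** With equal representatives, the differences of the [rho] are cycles, and [indet_cycles] applies
    to them. *)
Lemma massey_class_rho (c c' : massey_choice G x) :
  (forall i, mc_y c i = mc_y c' i) ->
  indet (x := x) G (massey_class c - massey_class c').
Proof.
move=> cc'; rewrite /massey_class /hcls -linearB.
have hyE : mc_hy c' = mc_hy c by apply/funext => i; rewrite /mc_hy cc'.
apply: (indet_cycles (mc_cls c) (rho := fun j => mc_rho c j - mc_rho c' j)) => [j|].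
  apply/(@cycP _ _ A _ _ erefl); rewrite linearB /= !mc_diff; apply/eqP.
  by rewrite subr_eq0; apply/eqP; apply: act_irr; rewrite hyE.
rewrite raddfB /= -sumrB; apply: eq_bigr => j _; rewrite -scalerBr; congr (_ *: _).
set h := sum_outer_args _; set h' := sum_outer_args _; set h'' := sum_outer_args _.
rewrite (@act_lin _ _ A _ _ _ (s_pos (G j)) _ (-1) (mc_rho c' j) (mc_rho c j)
   (mc_rho c j - mc_rho c' j) _ _ _ _ h'' h' h).
- by rewrite scaleN1r addrC.
- by rewrite /outer_args /graft unlift_none.
- by rewrite /outer_args /graft unlift_none.
- by rewrite /outer_args /graft unlift_none.
- by rewrite scaleN1r; exact: addrC.
move=> i; rewrite hyE /outer_args /graft eq_sym => /unlift_some [i' _ ->] //.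
Qed.

(** The class is kept exactly, not only modulo indeterminacy: [change_cycle] supplies the new [rho]
    and a chain [m] for each summand. *)
Lemma massey_class_change (c : massey_choice G x) i
    (v : sub_of (cyc A (tag (x i)))) :
  hcls v = tagged (x i) ->
  exists c' : massey_choice G x,
    [/\ massey_class c' = massey_class c, mc_y c' i = v
      & forall j, j != i -> mc_y c' j = mc_y c j].
Proof.
move=> vx; pose y := dfwith (mc_y c) v.
have yi : y i = v by exact: dfwith_in.
have yj j : j != i -> y j = mc_y c j by move=> ji; rewrite /y dfwith_out // eq_sym.
have yx j : hcls (y j) = tagged (x j).
  by case: (eqVneq j i) => [->|/yj ->]; rewrite ?yi ?mc_cls.
have [b db] : exists b, diff A erefl b = \val v - \val (mc_y c i).
  by apply/hcls_eq; rewrite vx mc_cls.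
pose hy j : hel A := hom (\val (y j)).
have hyi : hy i = hom (\val v) by rewrite /hy yi.
have hyj j : j != i -> hy j = mc_hy c j by move=> /yj e; rewrite /hy e.
have hu : g + \sum_j tag (homotopy_args (mc_hy c) i b j) = massey_deg g x.
  rewrite /massey_deg (bigD1 i) //= [in RHS](bigD1 i) //= /homotopy_args eqxx /=.
  rewrite [X in _ + (_ + X)](eq_bigr (fun j => tag (x j))); first by ring.
  by move=> j /negbTE ->.
have ch j := change_cycle (s := G j) (y := mc_hy c) (y' := hy) (rep_cyc (mc_y c))
  (erefl (mc_hy c i)) hyi hyj db (erefl (inner_deg G x j))
  (@sum_outer_args _ _ r g (G j) _ (fun a => tag a) (mc_hy c) (hom (mc_rho c j)) erefl)
  hu (mc_diff c j).
pose rho j := cid (ch j); pose m j := cid (svalP (rho j)).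
have drho j := (svalP (m j)).1; have dm j := (svalP (m j)).2.
exists (@MasseyChoice _ _ _ _ _ _ _ _ x y yx (fun j => sval (rho j)) drho); split=> //.
apply/hcls_eq; exists (sgn k (change_sign g (mc_hy c) i) *: \sum_j sval (m j)).
rewrite linearZ linear_sum /=; set C := sgn k _.
rewrite (eq_bigr _ (fun j _ => dm j (@sum_outer_args _ _ r g (G j) _ (fun a => tag a)
   hy (hom (sval (rho j))) erefl))).
(* The relation terms are all evaluated at the same arguments, so they sum to zero; the square of
   the common sign is 1. *)
rewrite big_split /= relation_act // add0r -scaler_sumr scalerA sgn_sqr scale1r.
rewrite /massey_cycle -sumrB; apply: eq_bigr => j _; rewrite scalerBr //.
Qed.

(** The representatives are replaced one at a time without changing the class, until only the [rho]
    differ. *)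
Lemma massey_class_indep (c c' : massey_choice G x) :
  indet (x := x) G (massey_class c - massey_class c').
Proof.
have main n : exists c1 : massey_choice G x, massey_class c1 = massey_class c /\
    forall j, mc_y c1 j = if (j < n)%N then mc_y c' j else mc_y c j.
  elim: n => [|n [c1 [c1c c1y]]]; first by exists c.
  have [ltnr|lern] := ltnP n r; last first.
    exists c1; split=> // j; rewrite c1y ltnS.
    by rewrite (leq_trans (ltn_ord j) lern) (ltnW (leq_trans (ltn_ord j) lern)).
  have [c2 [c2c c2i c2j]] := massey_class_change c1 (mc_cls c' (Ordinal ltnr)).
  exists c2; rewrite c2c; split=> // j; case: (eqVneq j (Ordinal ltnr)) => [->|ji].
    by rewrite c2i ltnSn.
  rewrite c2j // c1y ltnS [RHS](_ : _ = if (j < n)%N then mc_y c' j else mc_y c j) //.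
  rewrite leq_eqVlt; case: (eqVneq (j : nat) n) => // e.
  by case/eqP: ji; apply: val_inj.
have [c1 [<- c1y]] := main r.
by apply: massey_class_rho => i; rewrite c1y ltn_ord.
Qed.

End Choices.

(** The relation is fixed, while arguments and choices vary, since both have to be moved between
    algebras. *)
Definition massey_vanishing A :=
  forall (x : 'I_r -> hel (halg A)) (c : massey_choice G x),
    indet (x := x) G (massey_class c).

Lemma massey_vanishing_halg A : massey_vanishing (halg A).
Proof.
move=> x c; apply: (indet_cycles (mc_cls c) (rho := mc_rho c)) => //.
Qed.

(** * Transfer of vanishing along a quasi-isomorphism *)

Section Transfer.
Context (A B : dgalg (presented R)) (f : dgmor A B).

Section Push.
Context (x : 'I_r -> hel (halg A)).
Let fx i := hmap_hel f (x i).

Lemma push_cls (c : massey_choice G x) i :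
  hcls (to_sub (mor_cyc f (sub_ofP (mc_y c i)))) = tagged (fx i).
Proof. by rewrite /fx /hmap_hel /= -(mc_cls c i) hmap_cls. Qed.

Lemma push_diff (c : massey_choice G x) j :
  diff B erefl (f _ (mc_rho c j)) = alg_act B (pgen R (mu2 (G j)))
    (x := inner_args (s := G j)
            (fun i => hom (\val (to_sub (mor_cyc f (sub_ofP (mc_y c i)))))))
    (erefl (inner_deg G fx j)).
Proof. by rewrite -mor_diff mc_diff mor_act; apply: act_irr. Qed.

Definition push_choice (c : massey_choice G x) : massey_choice G fx :=
  @MasseyChoice _ _ _ _ _ _ _ _ fx _ (push_cls c) _ (push_diff c).

Lemma push_class (c : massey_choice G x) :
  massey_class (push_choice c) = hmap f (massey_class c).
Proof.
rewrite /massey_class hmap_cls; congr hcls; apply: val_inj => /=.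
rewrite /massey_cycle linear_sum; apply: eq_bigr => j _; rewrite linearZ /=.
congr (_ *: _); rewrite mor_act; apply: act_irr; apply/funext => i.
by rewrite /outer_args /graft; case: unlift.
Qed.

Lemma hmap_indet_term j (h : halg A (inner_deg G x j + 1)) :
  hmap f (indet_term h) = indet_term (G := G) (x := fx) (j := j) (hmap f h).
Proof.
rewrite /indet_term hmap_act; apply: (@act_irr _ _ (halg B)); apply/funext => i.
by rewrite /outer_args /graft; case: unlift.
Qed.

End Push.

Hypothesis f_qi : quasi_iso f.

(** Surjectivity on homology lifts the elements that witness the indeterminacy in [B]; injectivity
    brings the equality back to [A]. *)
Lemma massey_vanishing_source : massey_vanishing B -> massey_vanishing A.
Proof.
move=> vB x c; have := vB _ (push_choice c); rewrite push_class => -[h hE].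
have [fi fiK _] := f_qi (massey_deg g x).
have hx j : exists a : homology A (inner_deg G x j + 1), hmap f a = h j.
  by have [inv _ invK] := f_qi (inner_deg G x j + 1); exists (inv (h j)).
exists (fun j => sval (cid (hx j))).
apply: (can_inj fiK); rewrite hE raddf_sum; apply: eq_bigr => j _.
by rewrite /= hmap_indet_term (svalP (cid (hx j))).
Qed.

Lemma massey_vanishing_target : massey_vanishing A -> massey_vanishing B.
Proof.
move=> vA x.
(* The arguments lift by surjectivity on homology. *)
have [x' ->] : exists x', x = fun i => hmap_hel f (x' i).
  have hx i : exists a : homology A (tag (x i)), hmap f a = tagged (x i).
    by have [inv _ invK] := f_qi (tag (x i)); exists (inv (tagged (x i))).
  exists (fun i => hom (sval (cid (hx i)))); apply/funext => i.
  by rewrite /hmap_hel /= (svalP (cid (hx i))); case: (x i).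
move=> c.
(* The lifted product is defined because injectivity reflects the vanishing of the inner
   products. *)
have [c'] : inhabited (massey_choice G x').
  apply/massey_choiceP => j; have [inv fK _] := f_qi (inner_deg G x' j).
  apply: (can_inj fK); rewrite hmap_act linear0.
  exact: (massey_choiceP (fun i => hmap_hel f (x' i))).2 (inhabits c) j.
(* Modulo indeterminacy, the given choice may be exchanged for the push-forward of [c']. *)
rewrite -[massey_class c](subrK (massey_class (push_choice c'))).
rewrite -[X in X + _]scale1r; apply: indetL; first exact: massey_class_indep.
rewrite push_class; have [h ->] := vA _ c'.
exists (fun j => hmap f (h j)); rewrite raddf_sum; apply: eq_bigr => j _.
exact: hmap_indet_term.
Qed.

End Transfer.

Lemma massey_vanishing_qi A B :
  quasi_isomorphic A B -> massey_vanishing B -> massey_vanishing A.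
Proof.
elim=> // {}A B' C f fqi _ IH vC.
  exact: massey_vanishing_source fqi (IH vC).
exact: massey_vanishing_target fqi (IH vC).
Qed.

End Massey.

(** The equivalence records both that a Massey product exists and that zero is its only value. *)
Theorem corollary3p2 (k : fieldType) (char0 : [pchar k] =i pred0)
    (E : smodule k) (E_reduced : reduced_smodule E)
    (R : subsmodule (free_operad E))
    (R_quadratic : forall r d (x : free_operad E r d), R r d x -> fweight 2 x)
    (O_koszul : koszul R)
    (A : dgalg (presented R)) (A_formal : formal A)
    (r N : nat) (g : int) (G : 'I_N -> summand E r g)
    (G_rel : R r g (\sum_j sterm (G j)))
    (x : 'I_r -> hel (halg A)) (x_defined : massey_defined G x)
    (m : massey_target G x) :
  is_massey_product m <-> m = 0.
Proof.
have vA : massey_vanishing G_rel A.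
  by apply: massey_vanishing_qi A_formal _; exact: massey_vanishing_halg.
have cls0 (c : massey_choice G x) :
    mcls (indeterminacy G x) (massey_class G_rel c) = 0.
  by rewrite -(linear0 (mcls (indeterminacy G x))); apply/mcls_eq; rewrite subr0;
    exact: vA.
split=> [[c [z [zc ->]]]|->].
  by rewrite -(cls0 c) /massey_class; congr (mcls _ (hcls _)); apply: val_inj.
have [c] := (massey_choiceP G x).1 x_defined.
exists c, (to_sub (massey_cycle_cyc G_rel c)); split=> //.
exact: esym (cls0 c).
Qed.
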